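(* Let $\omega$ be a free ultrafilter on $\mathbb{N}$, let $H$ be a separable infinite-dimensional Hilbert space, and let $A$ be a self-adjoint operator on $H$. Let $H(A)$, $K(A)$, $\mathscr{D}_0\subset H_\omega$ be the subspaces, and $A_\omega$ (in $H(A)$) and $\widetilde{A}_\omega$ (in $K(A)$) the operators, defined in the context. Then: (1) $K(A)=H(A)$ and $A_\omega=\widetilde{A}_\omega$ (equality of operators, including domains). Moreover, $\mathscr{D}_0$ is a core for $A_\omega$. (2) Let $\xi\in\mathrm{dom}(A_\omega)$ and let $(\xi_n)_n\in\ell^\infty(\mathbb{N},H)$ be a representative of $\xi$ with $\xi_n\in\mathrm{dom}(A)$ for all $n$. Then $A_\omega\xi=(A\xi_n)_\omega$ holds (meaning that $(A\xi_n)_n$ is bounded and its class in $H_\omega$ equals $A_\omega\xi$) if and only if $(\xi_n)_n$ is a proper $A$-sequence.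
   Context: $\ell^\infty(\mathbb{N},H)$ is the space of bounded sequences in $H$. The ultrapower is $H_\omega=\ell^\infty(\mathbb{N},H)/\mathcal{T}_\omega$, where $\mathcal{T}_\omega=\{(\xi_n)_n:\lim_{n\to\omega}\|\xi_n\|=0\}$; the class of $(\xi_n)_n$ is written $(\xi_n)_\omega$, and $(\xi_n)_n$ is then called a representative of it. $H_\omega$ is a Hilbert space with $\langle(\xi_n)_\omega,(\eta_n)_\omega\rangle=\lim_{n\to\omega}\langle\xi_n,\eta_n\rangle$. A uniformly bounded sequence $(a_n)_n$ of bounded operators on $H$ defines a bounded operator $(a_n)_\omega$ on $H_\omega$ by $(a_n)_\omega(\xi_n)_\omega=(a_n\xi_n)_\omega$; for a constant sequence $a_n=a$ write $a_\omega$. The graph norm is $\|\xi\|_A=(\|\xi\|^2+\|A\xi\|^2)^{1/2}$ for $\xi\in\mathrm{dom}(A)$; $1_{[-a,a]}(A)$ denotes the spectral projection of $A$ for $[-a,a]$. A family of maps $\{f_n:\mathbb{R}\to H\}_{n\ge1}$ is $\omega$-equicontinuous if for every $t\in\mathbb{R}$ and $\varepsilon>0$ there are $\delta>0$ and $W\in\omega$ such that $\|f_n(t)-f_n(s)\|<\varepsilon$ for all $s$ with $|s-t|<\delta$ and all $n\in W$. $K(A)$ is the set of all $(\xi_n)_\omega\in H_\omega$ such that $\{t\mapsto e^{itA}\xi_n\}_{n\ge1}$ is $\omega$-equicontinuous (this does not depend on the representative). $K(A)$ is a closed subspace of $H_\omega$, invariant under all $(e^{itA})_\omega$, and $v(t)=(e^{itA})_\omega|_{K(A)}$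 is a strongly continuous one-parameter unitary group on $K(A)$. $\widetilde{A}_\omega$ is its self-adjoint generator given by Stone's theorem: $\mathrm{dom}(\widetilde{A}_\omega)=\{\xi\in K(A):\lim_{t\to0}\frac1t(v(t)-1)\xi\text{ exists}\}$ and $i\widetilde{A}_\omega\xi=\lim_{t\to0}\frac1t(v(t)-1)\xi$. $\mathscr{D}_A$ is the set of all $\xi\in H_\omega$ having a representative $(\xi_n)_n\in\ell^\infty(\mathbb{N},H)$ with $\xi_n\in\mathrm{dom}(A)$ for all $n$ and $(A\xi_n)_n$ bounded. $H(A)=\overline{\mathscr{D}_A}$ (norm closure in $H_\omega$). $A_\omega$ is the Krupa–Zawisza ultrapower of $A$: the operator in $H(A)$ with $\mathrm{dom}(A_\omega)=\mathscr{D}_A$ such that, for $\xi\in\mathscr{D}_A$ and $\eta\in H(A)$, $A_\omega\xi=\eta$ if and only if there is a representative $(\xi_n)_n\subset\mathrm{dom}(A)$ of $\xi$ with $(A\xi_n)_n$ bounded and $(A\xi_n)_\omega=\eta$. (It is a theorem of Krupa and Zawisza that this property determines a well-defined operator, which is self-adjoint in $H(A)$.) $\mathscr{D}_0$ is the set of all $\xi\in H_\omega$ for which there are a constant $a>0$ and a representative $(\xi_n)_n\in\ell^\infty(\mathbb{N},H)$ with $\xi_n\in1_{[-a,a]}(A)H$ for all $n$. An $A$-sequence is a sequence $(\xi_n)_n\in\ell^\infty(\mathbb{N},H)$ with $\xi_n\in\mathrm{dom}(A)$ for all $n$. An $A$-sequence $(\xi_n)_n$ is proper if $(A\xi_n)_n\in\ell^\infty(\mathbb{N},H)$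 and for each $\varepsilon>0$ there are $a>0$ and an $A$-sequence $(\eta_n)_n$ with $\eta_n\in1_{[-a,a]}(A)H$ for all $n$ and $\lim_{n\to\omega}\|\xi_n-\eta_n\|_A<\varepsilon$. *)

(* Defs.v *)
From HB Require Import structures.
From mathcomp Require Import all_boot all_order all_algebra.
From mathcomp Require Import generic_quotient ring_quotient sesquilinear.
From mathcomp Require Import complex.
From mathcomp Require Import all_classical all_reals all_analysis.
Import Order.TTheory GRing.Theory Num.Theory.
Import numFieldTopology.Exports numFieldNormedType.Exports.

Set Implicit Arguments.
Unset Strict Implicit.
Unset Printing Implicit Defensive.

Local Open Scope classical_set_scope.
Local Open Scope ring_scope.

Record free_ultrafilter := FreeUltrafilter {
  fu_sets :> set_system nat ;
  fu_ultra : UltraFilter fu_sets ;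
  fu_free : \bigcap_(W in fu_sets) W = set0 }.

#[global] Existing Instance fu_ultra.

(* The norm of a complex normed space takes its values in R[i]. *)
Definition rnorm (R : realType) (V : normedModType R[i]) (x : V) : R :=
  complex.Re `|x|.

Lemma rnormE (R : realType) (V : normedModType R[i]) (x : V) :
  `|x| = (rnorm x)%:C%C.
Proof. exact/esym/RRe_real/ger0_real/normr_ge0. Qed.

Section rnorm_theory.
Context (R : realType) (V : normedModType R[i]).
Implicit Types x y : V.

Lemma rnorm_ge0 x : 0 <= rnorm x.
Proof. by rewrite -lecR -rnormE; exact: normr_ge0. Qed.

Lemma rnorm0 : rnorm (0 : V) = 0.
Proof. by rewrite /rnorm normr0. Qed.

Lemma rnorm0_eq0 x : rnorm x = 0 -> x = 0.
Proof. by move=> x0; apply/normr0_eq0; rewrite rnormE x0. Qed.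

Lemma rnormD x y : rnorm (x + y) <= rnorm x + rnorm y.
Proof. by rewrite -lecR rmorphD/= -!rnormE; exact: ler_normD. Qed.

Lemma rnormN x : rnorm (- x) = rnorm x.
Proof. by rewrite /rnorm normrN. Qed.

Lemma rnormZ (a : R[i]) x : rnorm (a *: x) = complex.Re `|a| * rnorm x.
Proof.
apply: (@complexI R).
by rewrite -rnormE normrZ rmorphM/= -rnormE; congr (_ * _).
Qed.

Lemma ler_dist_rnorm x y : `|rnorm x - rnorm y| <= rnorm (x - y).
Proof.
have h (u v : V) : rnorm u <= rnorm (u - v) + rnorm v.
  by have := rnormD (u - v) v; rewrite subrK.
rewrite ler_norml lerBlDr h andbT lerNl opprB lerBlDr.
by rewrite -(rnormN (x - y)) opprB h.
Qed.

End rnorm_theory.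

Section ultrapower.
Context (R : realType) (V : normedModType R[i]).

Definition bounded_seq (u : nat -> V) : Prop :=
  exists M : R, forall n, rnorm (u n) <= M.

Definition bseq : {pred nat -> V} := fun u => `[< bounded_seq u >].

Lemma bseqP u : reflect (bounded_seq u) (u \in bseq).
Proof. exact: asboolP. Qed.

Lemma bseq_submod_closed : submod_closed bseq.
Proof.
split; first by apply/bseqP; exists 0 => n; rewrite rnorm0.
move=> a u v /bseqP[M uM] /bseqP[N vN]; apply/bseqP.
exists (complex.Re `|a| * M + N) => n /=.
apply: (le_trans (rnormD _ _)); rewrite lerD// rnormZ ler_wpM2l//.
by rewrite -lecR RRe_real; [exact: normr_ge0|exact/ger0_real/normr_ge0].
Qed.

HB.instance Definition _ := GRing.isSubmodClosed.Build R[i] (nat -> V) bseq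
  bseq_submod_closed.

Record linf := Linf { linf_val :> nat -> V ; linf_bseq : linf_val \in bseq }.

HB.instance Definition _ := [isSub for linf_val].
HB.instance Definition _ := [Choice of linf by <:].
HB.instance Definition _ := [SubChoice_isSubLmodule of linf by <:].

Lemma linf_bounded (u : linf) : bounded_seq u.
Proof. exact/bseqP/linf_bseq. Qed.

Variable omega : free_ultrafilter.

Lemma bounded_ultralimit (r : nat -> R) (M : R) :
  (forall n, `|r n| <= M) -> cvg (r n @[n --> fu_sets omega]).
Proof.
move=> rM.
have Ur : UltraFilter (r @ fu_sets omega).
  split; first exact: fmap_proper_filter.
  move=> G GF rG; rewrite eqEsubset; split=> // A GA.
  have [//|nA] := in_ultra_setVsetC (r @^-1` A) (fu_ultra omega).
  have GnA : G (~` A) by exact: rG.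
  have [x []//] := filter_ex (filterI GA GnA).
have := @segment_compact R (- M) M; rewrite compact_ultra => /(_ _ Ur).
have rI : (r @ fu_sets omega) `[- M, M]%classic.
  apply: (@filterE _ (fu_sets omega)) => n.
  by have := rM n; rewrite /= in_itv/= ler_norml.
by move=> /(_ rI)[l [_ rl]]; apply/cvg_ex; exists l.
Qed.

(* The null sequences along omega; the ultrapower is the quotient of linf by them. *)
Definition Tomega : {pred linf} :=
  fun u => `[< rnorm (u n) @[n --> fu_sets omega] --> (0 : R) >].

Lemma TomegaP (u : linf) :
  reflect (rnorm (u n) @[n --> fu_sets omega] --> (0 : R)) (u \in Tomega).
Proof. exact: asboolP. Qed.

Lemma Tomega_submod_closed : submod_closed Tomega.
Proof.
split.
  apply/TomegaP; rewrite (_ : (fun _ => _) = cst 0); first exact: cvg_cst.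
  by apply/funext => n /=; rewrite rnorm0.
move=> a u v /TomegaP u0 /TomegaP v0; apply/TomegaP.
apply: (@squeeze_cvgr _ _ _ _ (cst 0)
  (fun n => complex.Re `|a| * rnorm (u n) + rnorm (v n))).
- apply: filterE => n /=; rewrite rnorm_ge0/=.
  by apply: (le_trans (rnormD _ _)); rewrite rnormZ.
- exact: cvg_cst.
- rewrite -[X in _ --> X](addr0 (0 : R)) -[X in _ --> X + _](mulr0 (complex.Re `|a|)).
  by apply: cvgD => //; apply: cvgMr.
Qed.

HB.instance Definition _ := GRing.isSubmodClosed.Build R[i] linf Tomega
  Tomega_submod_closed.

Definition ultrapower : Type := (Quotient.quot Tomega).

HB.instance Definition _ := GRing.Zmodule.on ultrapower.

Local Notation cls := (\pi_(Quotient.quot Tomega)%qT : linf -> ultrapower).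

Lemma ucls_eq (u v : linf) : (cls u = cls v) <-> (u - v \in Tomega).
Proof. by rewrite Quotient.idealrBE; split => [/eqP|/eqP]. Qed.

Lemma cls_repr (x : ultrapower) : cls (repr x) = x.
Proof. exact: reprK. Qed.

Lemma clsD (u v : linf) : cls (u + v) = cls u + cls v.
Proof. exact: (raddfD (\pi_(Quotient.quot Tomega)%qT)). Qed.

Definition ultra_scale (a : R[i]) (x : ultrapower) : ultrapower :=
  cls (a *: repr x).

Lemma clsZ a (u : linf) : ultra_scale a (cls u) = cls (a *: u).
Proof.
apply/ucls_eq; rewrite -scalerBr rpredZ//.
by apply/ucls_eq; rewrite cls_repr.
Qed.

Lemma ultra_scaleA a b x : ultra_scale a (ultra_scale b x) = ultra_scale (a * b) x.
Proof. by rewrite -[x]cls_repr !clsZ scalerA. Qed.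

Lemma ultra_scale1 : left_id 1 ultra_scale.
Proof. by move=> x; rewrite -[x]cls_repr !clsZ scale1r. Qed.

Lemma ultra_scaleDr : right_distributive ultra_scale +%R.
Proof.
by move=> a x y; rewrite -[x]cls_repr -[y]cls_repr -clsD !clsZ -clsD scalerDr.
Qed.

Lemma ultra_scaleDl x : {morph ultra_scale^~ x : a b / a + b}.
Proof.
by move=> a b; rewrite -[x]cls_repr !clsZ -clsD scalerDl.
Qed.

HB.instance Definition _ := GRing.Zmodule_isLmodule.Build R[i] ultrapower
  ultra_scaleA ultra_scale1 ultra_scaleDr ultra_scaleDl.

Lemma is_cvg_rnorm (u : linf) : cvg (rnorm (u n) @[n --> fu_sets omega]).
Proof.
have [M uM] := linf_bounded u.
by apply: (@bounded_ultralimit _ M) => n; rewrite ger0_norm// rnorm_ge0.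
Qed.

Definition ultra_rnorm (x : ultrapower) : R :=
  lim (rnorm ((repr x : linf) n) @[n --> fu_sets omega]).

Lemma ultra_rnormE (u : linf) :
  ultra_rnorm (cls u) = lim (rnorm (u n) @[n --> fu_sets omega]).
Proof.
have uv : rnorm ((repr (cls u) - u) n) @[n --> fu_sets omega] --> (0 : R).
  by apply/(@TomegaP (repr (cls u) - u))/ucls_eq; rewrite cls_repr.
apply/cvg_lim => //.
apply: (@squeeze_cvgr _ _ _ _
  (fun n => rnorm (u n) - rnorm ((repr (cls u) - u) n))
  (fun n => rnorm (u n) + rnorm ((repr (cls u) - u) n))).
- apply: filterE => n /=; rewrite -ler_distl.
  exact: (ler_dist_rnorm (repr (cls u) n) (u n)).
- rewrite -[X in _ --> X]subr0; apply: cvgB => //; exact: is_cvg_rnorm.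
- rewrite -[X in _ --> X]addr0; apply: cvgD => //; exact: is_cvg_rnorm.
Qed.

Lemma ultra_rnormD x y : ultra_rnorm (x + y) <= ultra_rnorm x + ultra_rnorm y.
Proof.
rewrite -[x]cls_repr -[y]cls_repr -clsD !ultra_rnormE.
rewrite -limD; [|exact: is_cvg_rnorm..].
apply: ler_lim; [exact: is_cvg_rnorm| |].
  by apply: is_cvgD; exact: is_cvg_rnorm.
by apply: filterE => n; exact: rnormD.
Qed.

Lemma ultra_rnormZ (a : R[i]) x :
  ultra_rnorm (a *: x) = complex.Re `|a| * ultra_rnorm x.
Proof.
rewrite -[x]cls_repr [a *: _]clsZ !ultra_rnormE.
apply/cvg_lim => //; under eq_fun do rewrite rnormZ.
by apply: cvgM; [exact: cvg_cst|exact: is_cvg_rnorm].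
Qed.

Lemma ultra_rnorm0_eq0 x : ultra_rnorm x = 0 -> x = 0.
Proof.
rewrite -[x]cls_repr ultra_rnormE => x0.
rewrite -(raddf0 (\pi_(Quotient.quot Tomega)%qT)).
apply/ucls_eq; rewrite subr0; apply/TomegaP; rewrite -x0.
exact: is_cvg_rnorm.
Qed.

Definition ultra_norm (x : ultrapower) : R[i] := (ultra_rnorm x)%:C%C.

Lemma ultra_normD x y : ultra_norm (x + y) <= ultra_norm x + ultra_norm y.
Proof. by rewrite -rmorphD/= lecR ultra_rnormD. Qed.

Lemma ultra_normZ (a : R[i]) x : ultra_norm (a *: x) = `|a| * ultra_norm x.
Proof.
by rewrite /ultra_norm ultra_rnormZ rmorphM/=; congr (_ * _).
Qed.

Lemma ultra_norm0_eq0 x : ultra_norm x = 0 -> x = 0.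
Proof. by move=> [] /ultra_rnorm0_eq0. Qed.

HB.instance Definition _ := Lmodule_isNormed.Build R[i] ultrapower
  ultra_normD ultra_normZ ultra_norm0_eq0.

(* The class (w_n)_omega; unbounded sequences are sent to the junk value 0. *)
Definition ucls (w : nat -> V) : ultrapower := cls (insubd (0 : linf) w).

Definition represents (w : nat -> V) (x : ultrapower) : Prop :=
  bounded_seq w /\ ucls w = x.

(* The operator (a_n)_omega, computed on a chosen representative: for uniformly
   bounded linear a_n the class does not depend on that choice. *)
Definition ultra_op (a : nat -> V -> V) (x : ultrapower) : ultrapower :=
  ucls (fun n => a n ((repr x : linf) n)).

Lemma ucls_linf (u : linf) : ucls u = cls u.
Proof. by rewrite /ucls valKd. Qed.

Lemma represents_repr (x : ultrapower) : represents (repr x : linf) x.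
Proof. by split; [exact: linf_bounded|rewrite ucls_linf cls_repr]. Qed.

Lemma ucls_eqP (v w : nat -> V) : bounded_seq v -> bounded_seq w ->
  ucls v = ucls w <-> rnorm (v n - w n) @[n --> fu_sets omega] --> (0 : R).
Proof.
move=> /bseqP vb /bseqP wb.
have -> : v = Linf vb by []. have -> : w = Linf wb by [].
rewrite !ucls_linf ucls_eq.
by have P := TomegaP (Linf vb - Linf wb); split=> [/P|h]; [|apply/P].
Qed.

End ultrapower.

(* A partially defined map; values outside [dom] are irrelevant. *)
Record partial_op (V : Type) := PartialOp {
  dom : set V ;
  app :> V -> V }.

Definition op_eq (V : Type) (S T : partial_op V) : Prop :=
  dom S = dom T /\ forall x, dom S x -> S x = T x.

Section unbounded_operators.
Context (R : realType) (V : normedModType R[i]).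

Definition is_subspace (D : set V) : Prop :=
  D 0 /\ forall (a : R[i]) x y, D x -> D y -> D (a *: x + y).

Definition linear_op (T : partial_op V) : Prop :=
  is_subspace (dom T) /\
  forall (a : R[i]) x y, dom T x -> dom T y -> T (a *: x + y) = a *: T x + T y.

Definition graph_on (D : set V) (T : V -> V) : set (V * V) :=
  [set p | D p.1 /\ p.2 = T p.1].

(* D is a core for T: T is the closure of its restriction to D. *)
Definition is_core (D : set V) (T : partial_op V) : Prop :=
  [/\ is_subspace D, D `<=` dom T &
      closure (graph_on D T) = graph_on (dom T) T].

Definition bounded_linear (T : V -> V) : Prop :=
  (forall (a : R[i]) x y, T (a *: x + y) = a *: T x + T y) /\
  exists M : R, forall x, rnorm (T x) <= M * rnorm x.

Definition separable : Prop := exists2 D : set V, countable D & dense D.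

Definition infinite_dimensional : Prop :=
  forall (n : nat) (e : 'I_n -> V), exists x : V,
    forall c : 'I_n -> R[i], x <> \sum_(i < n) c i *: e i.

(* The form is linear in its first argument. *)
Context (dot : {dot V for Num.conj}).

(* A = A^*: the pairs (y, z) in the right-hand side are the graph of A, those
   on the left-hand side the graph of A^*. *)
Definition self_adjoint (A : partial_op V) : Prop :=
  [/\ linear_op A, dense (dom A) &
      forall y z, (forall x, dom A x -> dot (A x) y = dot x z) <->
                  (dom A y /\ A y = z)].

Definition orthogonal_projection (P : V -> V) : Prop :=
  [/\ bounded_linear P, forall x, P (P x) = P x &
      forall x y, dot (P x) y = dot x (P y)].

Implicit Types E : set (measurableTypeR R) -> V -> V.

Definition projection_valued_measure E : Prop :=
  [/\ forall B, measurable B -> orthogonal_projection (E B),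
      forall x, E setT x = x,
      (forall B C x, measurable B -> measurable C -> E (B `&` C) x = E B (E C x)) &
      forall (F : nat -> set (measurableTypeR R)) x,
        (forall i, measurable (F i)) -> trivIset setT F ->
        (\sum_(0 <= i < n) E (F i) x) @[n --> \oo] --> E (\bigcup_i F i) x].

(* The scalar measure B |-> <E(B)x, x> = ||E(B)x||^2. *)
Definition scalar_measure E (x : V) (B : set (measurableTypeR R)) : \bar R :=
  (rnorm (E B x) ^+ 2)%:E.

(* A is the integral of l dE(l); together with the linearity of A, the quadratic
   form determines A by polarization. *)
Definition spectral_measure_of (A : partial_op V) E : Prop :=
  [/\ projection_valued_measure E,
      forall x, dom A x <->
        (\int[scalar_measure E x]_l ((l : R) ^+ 2)%:E < +oo)%E &
      forall x, dom A x ->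
        dot (A x) x = (fine (\int[scalar_measure E x]_l (l : R)%:E)%E)%:C%C].

(* T is the integral of f dE, for a bounded Borel function f. *)
Definition is_spectral_integral E (f : R -> R[i]) (T : V -> V) : Prop :=
  bounded_linear T /\
  forall x, dot (T x) x =
    (fine (\int[scalar_measure E x]_l (complex.Re (f l))%:E)%E +i*
     fine (\int[scalar_measure E x]_l (complex.Im (f l))%:E)%E)%C.

Definition spectral_integral E (f : R -> R[i]) : V -> V :=
  xget (fun=> 0) [set T | is_spectral_integral E f T].

(* The operator e^{itA}, for E the spectral measure of A. *)
Definition expi E (t : R) : V -> V :=
  spectral_integral E (fun l => (cos (t * l) +i* sin (t * l))%C).

(* The range of 1_[-a,a](A), for E the spectral measure of A. *)
Definition spectral_subspace E (a : R) : set V :=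
  range (E `[- a, a]%classic).

Definition graph_norm (A : partial_op V) (x : V) : R :=
  Num.sqrt (rnorm x ^+ 2 + rnorm (A x) ^+ 2).

Variable omega : free_ultrafilter.

Definition omega_equicontinuous (f : nat -> R -> V) : Prop :=
  forall (t e : R), 0 < e -> exists2 d : R, 0 < d &
    exists2 W : set nat, fu_sets omega W &
      forall s n, `|s - t| < d -> W n -> rnorm (f n t - f n s) < e.

Definition KA E : set (ultrapower V omega) :=
  [set x | exists2 u, represents u x &
           omega_equicontinuous (fun n t => expi E t (u n))].

Definition ultra_expi E (t : R) : ultrapower V omega -> ultrapower V omega :=
  ultra_op (fun _ => expi E t).

Definition diff_quot E (x : ultrapower V omega) (t : R) : ultrapower V omega :=
  (t%:C%C)^-1 *: (ultra_expi E t x - x).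

Definition Atilde E : partial_op (ultrapower V omega) := PartialOp
  [set x | KA E x /\ cvg (diff_quot E x t @[t --> 0^'])]
  (fun x => ('i%C)^-1 *: lim (diff_quot E x t @[t --> 0^'])).

Definition A_sequence (A : partial_op V) (u : nat -> V) : Prop :=
  bounded_seq u /\ forall n, dom A (u n).

Definition DA (A : partial_op V) : set (ultrapower V omega) :=
  [set x | exists u, [/\ represents u x, forall n, dom A (u n) &
                         bounded_seq (fun n => A (u n))]].

Definition HA (A : partial_op V) : set (ultrapower V omega) := closure (DA A).

(* The Krupa-Zawisza ultrapower; that the class y below exists and is unique for
   x in DA A is their theorem, so [xget] picks that y. *)
Definition Aomega (A : partial_op V) : partial_op (ultrapower V omega) :=
  PartialOp (DA A) (fun x => xget 0
    [set y | HA A y /\ exists u, [/\ represents u x, forall n, dom A (u n),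
        bounded_seq (fun n => A (u n)) & ucls omega (fun n => A (u n)) = y]]).

Definition D0 E : set (ultrapower V omega) :=
  [set x | exists2 a : R, 0 < a &
           exists2 u, represents u x & forall n, spectral_subspace E a (u n)].

Definition proper_A_sequence (A : partial_op V) E (u : nat -> V) : Prop :=
  [/\ A_sequence A u, bounded_seq (fun n => A (u n)) &
      forall e : R, 0 < e -> exists2 a : R, 0 < a &
        exists v, [/\ A_sequence A v, forall n, spectral_subspace E a (v n) &
          lim (graph_norm A (u n - v n) @[n --> fu_sets omega]) < e]].

End unbounded_operators.

Arguments KA {R V} dot omega E.
Arguments Atilde {R V} dot omega E.
Arguments DA {R V} omega A.
Arguments HA {R V} omega A.
Arguments Aomega {R V} omega A.
Arguments D0 {R V} omega E.
Arguments proper_A_sequence {R V} omega A E u.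

(* Main.v *)
(** Writing P_a for the spectral projection of A for [-a, a] and U_t for
    e^{itA}, call a bounded sequence (u_n) tight if for each e > 0 there is k
    such that |u_n - P_k u_n| < e for omega-almost all n. Both H(A) and K(A)
    are the set of classes of tight sequences. For H(A), this is because k
    |u - P_k u| <= |A u|. For K(A), averaging the vectors U_s u over 0 <= s <
    d/2 moves u by at most e if |U_s u - u| <= e for |s| < d, but nearly
    annihilates the part of u with spectrum outside [-a, a] once d a is large.
    Tightness also makes A_omega well defined, since P_k A = A P_k is bounded,
    and the operators are compared through the estimates
    |U_t f - f - i t A f| <= 2 (t a)^2 |f| on the range of P_a and
    |U_t f - f| <= 2 |t| |A f|. Elements of dom(A_omega) are produced by a
    diagonal argument: f_n = P_{a_n} u_n with a_n -> oo slowly along omega.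

    All operator estimates come from the functional calculus f |-> f(A) for
    bounded measurable real f, where f(A) is the unique linear map with
    quadratic form x |-> \int f d<E x, x>; a self-adjoint operator is bounded
    by the bound of its quadratic form, so the calculus extends from indicator
    functions by uniform limits. *)

From HB Require Import structures.
Require Import Defs.
From mathcomp Require Import all_boot all_order all_algebra.
From mathcomp Require Import sesquilinear complex ring lra.
From mathcomp Require Import all_classical all_reals all_analysis
  measurable_realfun.
Import Order.TTheory GRing.Theory Num.Theory.
Import numFieldTopology.Exports numFieldNormedType.Exports.

Local Open Scope classical_set_scope.
Local Open Scope ring_scope.

Set Implicit Arguments.
Unset Strict Implicit.
Unset Printing Implicit Defensive.

(** * Inner products and quadratic forms *)

Section linear_maps.
Context {R : realType} {U V : lmodType R[i]} (T : U -> V).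
Context (linT : linear T).

(** Tightness is needed because boundedness of [A u_n] does not determine its class: if
    [A e_n = n e_n] for unit vectors [e_n], then [u_n = e_n / n] represents 0 while [A u_n = e_n]
    does not. Requiring the class of [A u_n] to lie in H(A), that is, requiring [A u_n] to be tight
    as well, removes the ambiguity; the proper sequences turn out to be those with [A u_n] bounded
    and tight. The spectral measure is tied to [A] only through the domain and the quadratic form of
    [A], so even the identity of [A] with a function of [E] on the range of P_a has to be derived.
    Norm estimates then become pointwise ones through |f(A) x|^2 = \int f^2 d<E x, x>. The average
    over time is a finite sum of vectors U_{kh} u, on which U_h - 1 telescopes. The lower bound for
    U_h - 1 needs h times the spectral variable to be small, so the spectrum is also cut at a second
    level b; h depends on b, the final estimate does not. Closedness of A_omega and the inclusion of
    the domain of the generator in that of A_omega rest on one and the same limit argument. *)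

Lemma linear_map0 : T 0 = 0.
Proof. by have := linT (-1) 0 0;
  rewrite scaleN1r oppr0 addr0 scaleN1r addNr. Qed.

Lemma linear_mapD x y : T (x + y) = T x + T y.
Proof. by have := linT 1 x y; rewrite !scale1r. Qed.

Lemma linear_mapZ a x : T (a *: x) = a *: T x.
Proof. by have := linT a x 0; rewrite !addr0 linear_map0 addr0. Qed.

Lemma linear_mapB x y : T (x - y) = T x - T y.
Proof. by rewrite -scaleN1r linear_mapD linear_mapZ scaleN1r. Qed.

End linear_maps.

Section inner_product.
Context {R : realType} {H : completeNormedModType R[i]}.
Context (dot : {dot H for Num.conj}).
Context (dot_norm : forall x : H, `|x| ^+ 2 = dot x x).
Implicit Types (x y z : H) (T : H -> H).

Lemma dotDl x y z : dot (x + y) z = dot x z + dot y z.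
Proof. by rewrite linearDl. Qed.

Lemma dotDr x y z : dot x (y + z) = dot x y + dot x z.
Proof. by rewrite linearDr. Qed.

Lemma dotBl x y z : dot (x - y) z = dot x z - dot y z.
Proof. by rewrite linearBl. Qed.

Lemma dotBr x y z : dot x (y - z) = dot x y - dot x z.
Proof. by rewrite linearBr. Qed.

Lemma dotZl a x y : dot (a *: x) y = a * dot x y.
Proof. by rewrite linearZl_LR. Qed.

Lemma dotZr a x y : dot x (a *: y) = (a^*)%C * dot x y.
Proof. by rewrite linearZr_LR. Qed.

Lemma dotC x y : dot x y = ((dot y x)^*)%C.
Proof. by rewrite hermC expr0 mul1r. Qed.

Lemma dot_rnorm x : dot x x = (rnorm x ^+ 2)%:C%C.
Proof. by rewrite -dot_norm rnormE rmorphXn. Qed.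

Lemma conjc_i : (('i : R[i])^*)%C = - 'i%C.
Proof. by apply/eqP; rewrite eq_complex/= oppr0 !eqxx. Qed.

(** The diagonal at [x + y] and at ['i *: x + y] gives both the sum and the difference of [D x y]
    and [D y x]. *)
Lemma polarization0 (D : H -> H -> R[i]) :
  (forall x y z, D (x + y) z = D x z + D y z) ->
  (forall x y z, D x (y + z) = D x y + D x z) ->
  (forall x y, D ('i%C *: x) y = 'i%C * D x y) ->
  (forall x y, D x ('i%C *: y) = - 'i%C * D x y) ->
  (forall x, D x x = 0) -> forall x y, D x y = 0.
Proof.
move=> Dl Dr Zl Zr D0 x y.
have h1 : D x y + D y x = 0.
  by have := D0 (x + y); rewrite Dl !Dr !D0 add0r addr0.
have h2 : 'i%C * D x y - 'i%C * D y x = 0.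
  have := D0 ('i%C *: x + y).
  by rewrite Dl !Dr !D0 add0r addr0 Zl Zr mulNr.
have i0 : ('i%C : R[i]) != 0 by rewrite eq_complex/= oner_eq0 andbF.
move: h2; rewrite -mulrBr => /eqP;
  rewrite mulf_eq0 (negbTE i0)/= subr_eq0 => /eqP h2.
move: h1; rewrite -h2 -mulr2n => /eqP.
by rewrite mulrn_eq0/= => /eqP.
Qed.

(** Source of the uniqueness of operators given by a quadratic form. Complex scalars matter: a
    quarter turn of the real plane has zero form. *)
Lemma quad_form_eq0 T : linear T -> (forall x, dot (T x) x = 0) ->
  forall x, T x = 0.
Proof.
move=> lT T0 x; apply/eqP; rewrite -(dnorm_eq0 dot); apply/eqP.
apply: (@polarization0 (fun x y => dot (T x) y)) => //.
- by move=> u v w; rewrite (linear_mapD lT) dotDl.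
- by move=> u v w; rewrite dotDr.
- by move=> u v; rewrite (linear_mapZ lT) dotZl.
- by move=> u v; rewrite dotZr conjc_i.
Qed.

Lemma real_quad_form_symmetric T (r : H -> R) : linear T ->
  (forall x, dot (T x) x = (r x)%:C%C) -> forall x y, dot (T x) y = dot x (T y).
Proof.
move=> lT Tr x y; apply/eqP; rewrite -subr_eq0; apply/eqP.
apply: (@polarization0 (fun x y => dot (T x) y - dot x (T y))).
- by move=> u v w; rewrite (linear_mapD lT) !dotDl; ring.
- by move=> u v w; rewrite (linear_mapD lT) !dotDr; ring.
- by move=> u v; rewrite (linear_mapZ lT) !dotZl mulrBr.
- by move=> u v; rewrite (linear_mapZ lT) !dotZr conjc_i mulrBr.
- by move=> u; rewrite [dot u _]dotC Tr conjc_real subrr.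
Qed.

Lemma rnormDsq x y :
  rnorm (x + y) ^+ 2 = rnorm x ^+ 2 + rnorm y ^+ 2 + 2 * complex.Re (dot x y).
Proof.
apply: (@complexI R); rewrite -dot_rnorm dnormD !rmorphD/= -!dot_rnorm.
congr (_ + _); case: (dot x y) => a b.
by apply/eqP; rewrite eq_complex/= subrr mulr_natl mulr2n !eqxx.
Qed.

Lemma rnormBsq x y :
  rnorm (x - y) ^+ 2 = rnorm x ^+ 2 + rnorm y ^+ 2 - 2 * complex.Re (dot x y).
Proof.
rewrite rnormDsq rnormN; congr (_ + _); rewrite -[- y]sub0r dotBr linear0r.
by rewrite sub0r -mulrN; congr (_ * _); case: (dot x y).
Qed.

(** [T] is symmetric, so [4 Re <T x, y> = r (x + y) - r (x - y)], which the parallelogram law bounds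
    by [2 M (|x|^2 + |y|^2)]. *)
Lemma bounded_quad_form T (r : H -> R) (M : R) : linear T ->
  (forall x, dot (T x) x = (r x)%:C%C) ->
  (forall x, `|r x| <= M * rnorm x ^+ 2) ->
  forall x, rnorm (T x) <= M * rnorm x.
Proof.
move=> lT Tr rM.
have sT := real_quad_form_symmetric lT Tr.
have ineq x y : 4 * complex.Re (dot (T x) y) <=
    2 * M * (rnorm x ^+ 2 + rnorm y ^+ 2).
  have rE z : r z = complex.Re (dot (T z) z) by rewrite Tr.
  have -> : 4 * complex.Re (dot (T x) y) = r (x + y) - r (x - y).
    rewrite !rE (linear_mapD lT) (linear_mapB lT).
    rewrite !(dotBl, dotBr, dotDl, dotDr).
    have -> : dot (T y) x = ((dot (T x) y)^*)%C by rewrite sT dotC.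
    case: (dot (T x) x) => a1 b1; case: (dot (T y) y) => a2 b2.
    case: (dot (T x) y) => a3 b3; by rewrite /=; ring.
  have := rM (x + y); have := rM (x - y); rewrite !ler_norml rnormBsq rnormDsq.
  by move=> /andP[h1 _] /andP[_ h2]; lra.
(* The sign of [M] is not given; when [T x = 0] with [x] nonzero it is read off from the bound on
   [r x]. *)
move=> x; have [->|Tx0] := eqVneq (rnorm (T x)) 0.
  have [/eqP x0|x0] := eqVneq (rnorm x) 0; first by rewrite (eqP x0) mulr0.
  have := rM x; move=> /(le_trans (normr_ge0 _)).
  rewrite pmulr_lge0; last by rewrite exprn_gt0// lt_def x0 rnorm_ge0.
  by move=> M0; rewrite mulr_ge0// rnorm_ge0.
have Tp : 0 < rnorm (T x) by rewrite lt_def Tx0 rnorm_ge0.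
have xp : 0 < rnorm x.
  rewrite lt_def rnorm_ge0 andbT; apply: contra_neq Tx0 => /rnorm0_eq0 ->.
  by rewrite (linear_map0 lT) rnorm0.
(* Both vectors are scaled to the norm [|x| |T x|], where the inequality is sharpest. *)
have := ineq ((rnorm (T x))%:C%C *: x) ((rnorm x)%:C%C *: T x).
rewrite (linear_mapZ lT) dotZl dotZr conjc_real dot_rnorm -!rmorphM/=.
rewrite !rnormZ !normc_def/= !expr0n/= !addr0 !sqrtr_sqr !ger0_norm
  ?rnorm_ge0//.
move=> h.
have h2 : (rnorm (T x) ^+ 2 * rnorm x) * rnorm (T x) <=
    (rnorm (T x) ^+ 2 * rnorm x) * (M * rnorm x).
  by move: h; rewrite !expr2; lra.
by rewrite ler_pM2l// in h2; rewrite mulr_gt0// exprn_gt0.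
Qed.

(** Cauchy-Schwarz, by expanding the squared norm of [|y| x - |x| y]. *)
Lemma Re_dot_le x y : complex.Re (dot x y) <= rnorm x * rnorm y.
Proof.
have [/rnorm0_eq0 ->|x0] := eqVneq (rnorm x) 0.
  by rewrite linear0l rnorm0 mul0r.
have xp : 0 < rnorm x by rewrite lt_def x0 rnorm_ge0.
have /= h := rnorm_ge0 ((rnorm y)%:C%C *: x - (rnorm x)%:C%C *: y).
have := sqr_ge0 (rnorm ((rnorm y)%:C%C *: x - (rnorm x)%:C%C *: y)).
rewrite rnormBsq dotZl dotZr conjc_real mulrA -rmorphM.
rewrite !rnormZ !normc_def/= !expr0n/= !addr0 !sqrtr_sqr !ger0_norm
  ?rnorm_ge0//.
have [/rnorm0_eq0 ->|y0] := eqVneq (rnorm y) 0.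
  by rewrite linear0r rnorm0 mulr0.
have yp : 0 < rnorm y by rewrite lt_def y0 rnorm_ge0.
have -> : complex.Re ((rnorm y * rnorm x)%:C%C * dot x y) =
    (rnorm y * rnorm x) * complex.Re (dot x y).
  by case: (dot x y) => a b /=; rewrite mul0r subr0.
move=> h2; rewrite -(ler_pM2l (mulr_gt0 yp xp)).
by move: h2; rewrite !expr2; lra.
Qed.

Lemma abs_Re_dot_le x y : `|complex.Re (dot x y)| <= rnorm x * rnorm y.
Proof.
rewrite ler_norml Re_dot_le andbT lerNl -(rnormN x).
apply: le_trans (Re_dot_le _ _); rewrite -[- x]sub0r dotBl linear0l sub0r.
by case: (dot x y).
Qed.

Lemma abs_Im_dot_le x y : `|complex.Im (dot x y)| <= rnorm x * rnorm y.
Proof.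
have -> : rnorm y = rnorm ('i%C *: y).
  by rewrite rnormZ normc_def/= expr0n expr1n add0r sqrtr1 mul1r.
apply: le_trans (abs_Re_dot_le _ _); rewrite dotZr conjc_i.
by case: (dot x y) => a b /=; rewrite oppr0 mul0r sub0r mulN1r opprK.
Qed.

End inner_product.

(** * Bounded measurable functions *)

Section rnorm_topology.
Context {R : realType} {V : normedModType R[i]}.

Lemma rnormB_C (x y : V) : rnorm (x - y) = rnorm (y - x).
Proof. by rewrite -rnormN opprB. Qed.

(** Radii of balls in [V] lie in [R[i]]; a positive element of [R[i]] is real, so real radii
    suffice. *)
Lemma rnorm_cvgP {T : Type} (F : set_system T) {FF : Filter F} (f : T -> V) l :
  f @ F --> l <-> forall e : R, 0 < e -> \forall x \near F, rnorm (l - f x) < e.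
Proof.
split.
  move=> /cvgrPdist_lt h e e0; have := h e%:C%C; rewrite ltcR => /(_ e0).
  by apply: filterS => x; rewrite rnormE ltcR.
move=> h; apply/cvgrPdist_lt => e e0.
have er : (complex.Re e)%:C%C = e by apply/RRe_real/gtr0_real.
have := h (complex.Re e); rewrite -ltcR er => /(_ e0).
by apply: filterS => x; rewrite -ltcR er -rnormE.
Qed.

End rnorm_topology.

Lemma rnorm_complete {R : realType} {H : completeNormedModType R[i]}
  (u : nat -> H) (r : nat -> R) : r n @[n --> \oo] --> (0 : R) ->
  (forall m n, (m <= n)%N -> rnorm (u m - u n) <= r m) ->
  cvg (u n @[n --> \oo]).
Proof.
move=> r0 ur; apply/cauchy_cvgP/cauchy_ballP => e e0.
have er : (complex.Re e)%:C%C = e by apply/RRe_real/gtr0_real.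
have e1 : 0 < complex.Re e by rewrite -ltcR er.
have /cvgrPdist_lt/(_ _ e1)[N _ rN] := r0.
exists ([set u n | n in [set n | (N <= n)%N]], [set u n | n in [set n | (N <=
  n)%N]]).
  by split; exists N => // n /= Nn; exists n.
have small m n : (N <= m)%N -> (m <= n)%N -> rnorm (u m - u n) < complex.Re e.
  move=> Nm mn; apply: (le_lt_trans (ur _ _ mn)).
  have := rN m Nm; rewrite /= sub0r normrN; apply: le_lt_trans; exact: ler_norm.
move=> [_ _] /= [[m Nm <-] [n Nn <-]].
rewrite -ball_normE /ball_/= -er rnormE ltcR.
have [mn|/ltnW nm] := leqP m n; first exact: small.
by rewrite rnormB_C; exact: small.
Qed.

Section bounded_measurable.
Context {R : realType}.
Implicit Types (f g : measurableTypeR R -> R) (B : set (measurableTypeR R)).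

Definition bmf f :=
  measurable_fun setT f /\ exists M : R, forall l, `|f l| <= M.

Lemma bmf_indic B : measurable B -> bmf \1_B.
Proof.
move=> mB; split; first exact: measurable_indic.
by exists 1 => l; rewrite indicE; case: (_ \in _); rewrite ?normr1 ?normr0.
Qed.

Lemma bmf_cst (c : R) : bmf (fun=> c).
Proof. by split; [exact: measurable_cst|exists `|c|]. Qed.

Lemma bmfD f g : bmf f -> bmf g -> bmf (fun l => f l + g l).
Proof.
move=> [mf [M fM]] [mg [N gN]]; split; first exact: measurable_funD.
by exists (M + N) => l; apply: (le_trans (ler_normD _ _)); rewrite lerD.
Qed.

Lemma bmfM f g : bmf f -> bmf g -> bmf (fun l => f l * g l).
Proof.
move=> [mf [M fM]] [mg [N gN]]; split; first exact: measurable_funM.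
by exists (M * N) => l; rewrite normrM ler_pM.
Qed.

Lemma bmfZ (a : R) f : bmf f -> bmf (fun l => a * f l).
Proof. by move=> bf; apply: bmfM => //; exact: bmf_cst. Qed.

(* A function [0 <= g <= 1] is approximated within [1/n] by the layer sum
   [n^-1 \sum_(1 <= k <= n) 1_{k <= n g}]. *)
Lemma layer_sum (y : R) n : 0 <= y <= n%:R ->
  `|y - \sum_(k < n) (k.+1%:R <= y)%R%:R| <= 1.
Proof.
move=> /andP[y0].
have full m : m%:R <= y -> \sum_(k < m) (k.+1%:R <= y)%R%:R = m%:R :> R.
  move=> my; rewrite (eq_bigr (fun=> 1)); first by rewrite sumr_const card_ord.
  by move=> k _; rewrite (le_trans _ my)// ler_nat.
elim: n => [|n IH] yn.
  by rewrite big_ord0 subr0 (le_trans _ ler01)// ger0_norm.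
rewrite big_ord_recr/=; have [ny|ny] := leP y n%:R.
  rewrite (_ : (_ <= y) = false); first by rewrite addr0 IH ?y0.
  by apply/negbTE; rewrite -ltNge (le_lt_trans ny)// ltr_nat.
rewrite (full _ (ltW ny)); move: yn ny; rewrite -natr1 => yn ny.
by case: (n%:R + 1 <= y) => /=; rewrite ?mulr1n ?mulr0n ler_norml; apply/andP;
  split; lra.
Qed.

(** Bounded measurable functions are uniform limits of simple ones. The fixed rate in the limit case
    provides explicit Cauchy bounds for operators. *)
Lemma bmf_ind (P : (measurableTypeR R -> R) -> Prop) :
  (forall B, measurable B -> P \1_B) ->
  (forall a f g, bmf f -> bmf g -> P f -> P g -> P (fun l => a * f l + g l)) ->
  (forall f (fn : nat -> measurableTypeR R -> R), bmf f ->
    (forall n, bmf (fn n)) -> (forall n, P (fn n)) ->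
    (forall n l, `|f l - fn n l| <= n.+1%:R^-1) -> P f) ->
  forall f, bmf f -> P f.
Proof.
move=> P1 Plin Plim.
have P0 : P (fun=> 0).
  by have := P1 set0 measurable0; congr P; apply/funext => l; rewrite indic0.
have Pc c : P (fun=> c).
  have := Plin c _ _ (bmf_indic measurableT) (bmf_cst 0) (P1 _ measurableT) P0.
  by congr P; apply/funext => l; rewrite indicT mulr1 addr0.
have Psum c n (B : nat -> set (measurableTypeR R)) : (forall k, measurable (B
  k)) ->
    let s := fun l => \sum_(k < n) c * \1_(B k) l in bmf s /\ P s.
  move=> mB /=; elim: n => [|n [bIH IH]].
    rewrite (_ : (fun _ => _) = fun=> 0); first by split => //; exact: bmf_cst.
    by apply/funext => l; rewrite big_ord0.
  rewrite (_ : (fun _ => _) =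
      fun l => c * \1_(B n) l + \sum_(k < n) c * \1_(B k) l).
    split; last by apply: Plin => //; [exact: bmf_indic|exact: P1].
    by apply: bmfD => //; apply: bmfZ; exact: bmf_indic.
  by apply/funext => l; rewrite big_ord_recr/= addrC.
have Pg g : measurable_fun setT g -> (forall l, 0 <= g l <= 1) -> P g.
  move=> mg g01.
  pose B (n k : nat) := [set l : measurableTypeR R | (k.+1%:R : R) <= n.+1%:R *
    g l].
  have mB n k : measurable (B n k).
    have -> : B n k = (fun l => n.+1%:R * g l) @^-1` `[k.+1%:R, +oo[%classic.
      by apply/seteqP; split => l; rewrite /B/= in_itv/= andbT.
    rewrite -[X in measurable X]setTI; apply: measurable_funM => //.
  pose gn (n : nat) (l : measurableTypeR R) : R := \sum_(k < n.+1) n.+1%:R^-1 *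
    \1_(B n k) l.
  have bg : bmf g.
    split => //; exists 1 => l; have /andP[g0 g1] := g01 l.
    by rewrite ger0_norm.
  apply: (Plim g gn bg) => [n|n|n l]; first exact: (Psum _ _ _ (mB n)).1.
    exact: (Psum _ _ _ (mB n)).2.
  have /andP[g0 g1] := g01 l.
  have n0 : (0 : R) < n.+1%:R by rewrite ltr0n.
  rewrite /gn -mulr_sumr -[X in `|X - _|](mulKf (lt0r_neq0 n0)).
  have n1 : (0 : R) <= n.+1%:R^-1 by rewrite invr_ge0 ler0n.
  rewrite -mulrBr normrM (ger0_norm n1) ler_piMr//.
  have -> : \sum_(k < n.+1) \1_(B n k) l =
      \sum_(k < n.+1) (k.+1%:R <= n.+1%:R * g l)%R%:R :> R.
    apply: eq_bigr => k _; rewrite indicE; congr (nat_of_bool _)%:R.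
    by apply/idP/idP => [/set_mem|h]; [|exact/mem_set].
  by apply: layer_sum; rewrite mulr_ge0 ?(ltW n0)//= ler_piMr// ltW.
move=> f [mf [M fM]].
(* The map [(f + K) / 2K] brings [f] into [0, 1]; the added 1 keeps [K] positive. *)
pose K := `|M| + 1; have K0 : 0 < K by rewrite ltr_wpDl.
pose g l := (2 * K)^-1 * (f l + K).
have g01 l : 0 <= g l <= 1.
  have := fM l; rewrite ler_norml => /andP[f1 f2].
  have MK : M <= K by rewrite (le_trans (ler_norm M))// lerDl.
  have K2 : 0 < 2 * K by lra.
  rewrite /g mulr_ge0 ?invr_ge0 ?(ltW K2)//=; last by lra.
  by rewrite ler_pdivrMl// mulr1; lra.
have mg : measurable_fun setT g.
  apply: measurable_funM => //; apply: measurable_funD => //.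
have bg : bmf g.
  by split => //; exists 1 => l; have /andP[g0 g1] := g01 l; rewrite ger0_norm.
have := Plin (2 * K) _ _ bg (bmf_cst (- K)) (Pg _ mg g01) (Pc _).
congr P; apply/funext => l; rewrite /g mulrA divff ?mul1r ?addrK//.
by rewrite mulf_neq0// gt_eqF.
Qed.

End bounded_measurable.

(** * The scalar spectral measures *)

Section spectral_calculus.
Context {R : realType} {H : completeNormedModType R[i]}.
Context (dot : {dot H for Num.conj}).
Context (dot_norm : forall x : H, `|x| ^+ 2 = dot x x).
Context {E : set (measurableTypeR R) -> H -> H}.
Context (pvmE : projection_valued_measure dot E).
Implicit Types (x y z : H) (T : H -> H) (B C : set (measurableTypeR R)).
Implicit Types (f g : measurableTypeR R -> R).

Lemma pvm_linear B : measurable B -> linear (E B).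
Proof. by case: pvmE => /(_ B) + _ _ _ mB => /(_ mB)[[]]. Qed.

Lemma pvm_idem B x : measurable B -> E B (E B x) = E B x.
Proof. by case: pvmE => /(_ B) + _ _ _ mB => /(_ mB)[]. Qed.

Lemma pvm_sym B x y : measurable B -> dot (E B x) y = dot x (E B y).
Proof. by case: pvmE => /(_ B) + _ _ _ mB => /(_ mB)[]. Qed.

Lemma pvmT x : E setT x = x.
Proof. by case: pvmE. Qed.

Lemma pvmI B C x : measurable B -> measurable C -> E (B `&` C) x = E B (E C x).
Proof. by case: pvmE => _ _ + _; exact. Qed.

Lemma pvmC B C x : measurable B -> measurable C -> E B (E C x) = E C (E B x).
Proof. by move=> mB mC; rewrite -!pvmI// setIC. Qed.

Lemma dot_pvm B x : measurable B -> dot (E B x) x = (rnorm (E B x) ^+ 2)%:C%C.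
Proof. by move=> mB; rewrite -(dot_rnorm dot_norm) -pvm_sym// pvm_idem. Qed.

Lemma rnorm_pvm_le B x : measurable B -> rnorm (E B x) <= rnorm x.
Proof.
move=> mB; have [->|x0] := eqVneq (rnorm (E B x)) 0; first exact: rnorm_ge0.
have xp : 0 < rnorm (E B x) by rewrite lt_def x0 rnorm_ge0.
by have := Re_dot_le dot_norm (E B x) x; rewrite dot_pvm//= expr2 ler_pM2l.
Qed.

Lemma rnorm_pvmC B x : measurable B ->
  rnorm (x - E B x) ^+ 2 = rnorm x ^+ 2 - rnorm (E B x) ^+ 2.
Proof.
by move=> mB; rewrite (rnormBsq dot_norm) -pvm_sym// dot_pvm//=; ring.
Qed.

(** Countable additivity for the constant empty sequence: the partial sums converge, while
    consecutive ones differ by [E set0 x]. *)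
Lemma pvm0 x : E set0 x = 0.
Proof.
case: pvmE => _ _ _ /(_ (fun=> set0) x (fun=> measurable0)).
move=> /(_ (@trivIset_set0 _ _ _)).
rewrite (_ : \bigcup_i set0 = set0); last by rewrite bigcup0.
move=> /rnorm_cvgP cv; apply/rnorm0_eq0/eqP; rewrite eq_le rnorm_ge0 andbT.
apply/ler_addgt0Pr => e e0; rewrite add0r.
have [N _ hN] := cv (e / 2) (divr_gt0 e0 (ltr0n _ 2)).
have h1 := hN N (leqnn N); have h2 := hN N.+1 (leqnSn N).
set S := fun n => \sum_(0 <= i < n) E set0 x.
have -> : E set0 x = (E set0 x - S N) - (E set0 x - S N.+1).
  by rewrite /S big_nat_recr//= opprB addrK subrK.
rewrite -/(S N) -/(S N.+1) in h1 h2 *.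
apply: (le_trans (rnormD _ _)); rewrite rnormN.
by move: h1 h2 => /=; rewrite -/(S N) -/(S N.+1) => h1 h2; lra.
Qed.

Definition spectral_mu x : set (measurableTypeR R) -> \bar R :=
  scalar_measure E x.

Let mu0 x : spectral_mu x set0 = 0%E.
Proof. by rewrite /spectral_mu /scalar_measure pvm0 rnorm0 expr0n. Qed.

Let mu_ge0 x B : (0 <= spectral_mu x B)%E.
Proof. by rewrite lee_fin sqr_ge0. Qed.

(** Since [|E B x|^2 = <E B x, x>], the convergence of the sums of [E (F i) x] in norm passes to the
    measures by Cauchy-Schwarz. *)
Let mu_sigma_additive x : semi_sigma_additive (spectral_mu x).
Proof.
move=> F mF tF mUF; rewrite /spectral_mu/scalar_measure.
under eq_fun do rewrite sumEFin.
apply: cvg_EFin; first exact: nearW.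
have Fcv := (let: And4 _ _ _ h := pvmE in h) F x mF tF.
have sE n : (\sum_(0 <= i < n) rnorm (E (F i) x) ^+ 2) =
    complex.Re (dot (\sum_(0 <= i < n) E (F i) x) x).
  elim: n => [|n IH]; first by rewrite !big_geq// linear0l.
  rewrite !big_nat_recr//= dotDl IH dot_pvm//.
  by case: (dot _ _).
under eq_fun do rewrite /= sE.
have -> : rnorm (E (\bigcup_i F i) x) ^+ 2 =
  complex.Re (dot (E (\bigcup_i F i) x) x) by rewrite dot_pvm.
apply/cvgrPdist_lt => e e0.
have xp : 0 < rnorm x + 1 by rewrite ltr_wpDl// rnorm_ge0.
have /rnorm_cvgP/(_ _ (divr_gt0 e0 xp)) := Fcv.
apply: filterS => n; rewrite ltr_pdivlMr// => h.
set l := E _ x in h *; set s := \sum_(0 <= i < n) _ in h *.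
have ReB (a b : R[i]) : complex.Re a - complex.Re b = complex.Re (a - b).
  by case: a; case: b.
have bound (u v : H) : rnorm (u - v) * (rnorm x + 1) < e ->
    complex.Re (dot u x) - complex.Re (dot v x) < e.
  rewrite ReB -dotBl => uv; apply: le_lt_trans (Re_dot_le dot_norm _ _) _.
  by apply: le_lt_trans uv; rewrite ler_wpM2l ?rnorm_ge0// lerDl.
rewrite ltr_norml; apply/andP; split; last exact: bound.
by rewrite ltrNl opprB; apply: bound; rewrite rnormB_C.
Qed.

HB.instance Definition _ x := isMeasure.Build _ _ _ (spectral_mu x)
  (mu0 x) (mu_ge0 x) (@mu_sigma_additive x).

Definition sint x f : R := fine (\int[scalar_measure E x]_l (f l)%:E)%E.

Lemma bmf_integrable x f : bmf f ->
  (spectral_mu x : {measure set _ -> \bar R}).-integrable setT (EFin \o f).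
Proof.
move=> [mf [M fM]]; apply: measurable_bounded_integrable => //.
  exact: ltry.
by exists M; split; [exact: num_real|move=> N MN l _; exact: le_trans (ltW MN)].
Qed.

Lemma sint_lin x a f g : bmf f -> bmf g ->
  sint x (fun l => a * f l + g l) = a * sint x f + sint x g.
Proof.
move=> bf bg.
have := @RintegralD _ _ _ (spectral_mu x) setT (fun l => a * f l) g measurableT
  (bmf_integrable x (bmfZ a bf)) (bmf_integrable x bg).
rewrite (@RintegralZl _ _ _ (spectral_mu x)) //; exact: bmf_integrable.
Qed.

Lemma sint_indic x B : measurable B -> sint x \1_B = rnorm (E B x) ^+ 2.
Proof.
move=> mB; rewrite /sint.
by rewrite (integral_indic (spectral_mu x) measurableT mB) setIT.
Qed.

Lemma sint_ge0 x f : (forall l, 0 <= f l) -> 0 <= sint x f.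
Proof. by move=> f0; exact: (@Rintegral_ge0 _ _ _ (spectral_mu x)). Qed.

Lemma sintD x f g : bmf f -> bmf g ->
  sint x (fun l => f l + g l) = sint x f + sint x g.
Proof.
move=> bf bg; rewrite -[sint x f]mul1r -sint_lin//.
by congr sint; apply/funext => l; rewrite mul1r.
Qed.

Lemma sint_cst x (c : R) : sint x (fun=> c) = c * rnorm x ^+ 2.
Proof.
rewrite -[in RHS](pvmT x).
exact: (@Rintegral_cst _ _ _ (spectral_mu x) setT measurableT c).
Qed.

Lemma sintZ x a f : bmf f -> sint x (fun l => a * f l) = a * sint x f.
Proof.
move=> bf; have := @sint_lin x a f (fun=> 0) bf (bmf_cst 0).
rewrite sint_cst mul0r addr0 => <-.
by congr sint; apply/funext => l; rewrite addr0.
Qed.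

Lemma sintB x f g : bmf f -> bmf g ->
  sint x (fun l => f l - g l) = sint x f - sint x g.
Proof.
move=> bf bg; have := @sint_lin x (-1) g f bg bf.
rewrite mulN1r addrC => <-.
by congr sint; apply/funext => l; rewrite mulN1r addrC.
Qed.

Lemma le_sint x f g : bmf f -> bmf g -> (forall l, f l <= g l) ->
  sint x f <= sint x g.
Proof.
by move=> bf bg fg; rewrite -subr_ge0 -sintB// sint_ge0// => l;
  rewrite subr_ge0.
Qed.

Lemma sint_bound x f M : bmf f -> (forall l, `|f l| <= M) ->
  `|sint x f| <= M * rnorm x ^+ 2.
Proof.
move=> bf fM; rewrite ler_norml -mulNr -!sint_cst; apply/andP; split.
  by apply: le_sint => // [|l]; [exact: bmf_cst|have := fM l;
    rewrite ler_norml => /andP[]].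
by apply: le_sint => // [|l]; [exact: bmf_cst|have := fM l;
  rewrite ler_norml => /andP[]].
Qed.

Lemma integral_bmf x f : bmf f ->
  (\int[scalar_measure E x]_l (f l)%:E)%E = (sint x f)%:E.
Proof.
move=> bf; rewrite /sint fineK//.
exact: (integrable_fin_num measurableT (bmf_integrable x bf)).
Qed.

(** Unbounded functions are allowed: on a vector in the range of a spectral projection, [l] and
    [l ^+ 2] can be replaced by bounded truncations. *)
Lemma eq_integral_supp x B f g : measurable B ->
  measurable_fun setT f -> measurable_fun setT g ->
  E (~` B) x = 0 -> (forall l, B l -> f l = g l) ->
  (\int[scalar_measure E x]_l (f l)%:E = \int[scalar_measure E x]_l (g l)%:E)%E.
Proof.
move=> mB mf mg EB fg.
apply: (@ae_eq_integral _ _ _ (spectral_mu x)) => //;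
  try exact/measurable_EFinP.
exists (~` B); split; first exact: measurableC.
  have -> : 0%E = scalar_measure E x (~` B) by rewrite /scalar_measure EB
    rnorm0 expr0n.
  by [].
by move=> l /= /not_implyP[_ h] Bl; apply: h; rewrite fg.
Qed.

(** Continuity of the scalar measure from below, converted to norms by Pythagoras. *)
Lemma pvm_segment_cvg x e : 0 < e ->
  exists2 N : nat, (0 < N)%N & forall n, (N <= n)%N ->
    rnorm (x - E `[- n%:R, n%:R]%classic x) < e.
Proof.
move=> e0; pose F n : set (measurableTypeR R) := `[- n%:R, n%:R]%classic.
have UF : \bigcup_n F n = setT := bigcup_itvT true false.
have := @nondecreasing_cvg_mu _ _ _ (spectral_mu x) F
  (fun n => measurable_itv _).
rewrite UF => /(_ measurableT).
have ndF : nondecreasing_seq F.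
  move=> m n mn; rewrite subsetEset => l; rewrite /F/= !in_itv/=.
  have := mn; rewrite -(ler_nat R) => h /andP[h1 h2].
  by apply/andP; split; lra.
move=> /(_ ndF)/fine_cvgP[_] /cvgrPdist_lt/(_ _ (exprn_gt0 2 e0))[N _ NF].
exists N.+1 => // n Nn; have := NF n (ltnW Nn).
rewrite /= pvmT -rnorm_pvmC; last exact: measurable_itv.
rewrite ger0_norm ?sqr_ge0// ltr_pXn2r// nnegrE ?rnorm_ge0//.
exact: ltW.
Qed.

End spectral_calculus.

(** * Functional calculus *)

Lemma rnorm_vanish {R : realType} {V : normedModType R[i]} (v : V) (M : R) :
  (forall n, rnorm v <= M * n.+1%:R^-1) -> v = 0.
Proof.
move=> vM; apply/rnorm0_eq0/eqP; rewrite eq_le rnorm_ge0 andbT.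
have M0 : (fun n => M * n.+1%:R^-1) @ \oo --> (M * 0 : R).
  by apply: cvgMr; exact: cvg_harmonic.
rewrite mulr0 in M0; rewrite -(cvg_lim _ M0)//.
apply: limr_ge; first by apply/cvg_ex; exists 0.
exact: nearW.
Qed.

Section functional_calculus.
Context {R : realType} {H : completeNormedModType R[i]}.
Context (dot : {dot H for Num.conj}).
Context (dot_norm : forall x : H, `|x| ^+ 2 = dot x x).
Context (E : set (measurableTypeR R) -> H -> H).
Context (pvmE : projection_valued_measure dot E).
Implicit Types (x y z : H) (T : H -> H) (B C : set (measurableTypeR R)).
Implicit Types (f g : measurableTypeR R -> R).

Local Notation sint := (@sint R H E).

Definition is_calc f T :=
  linear T /\ forall x, dot (T x) x = (sint x f)%:C%C.

Lemma is_calc_uniq f S T : is_calc f S -> is_calc f T -> S =1 T.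
Proof.
move=> [lS qS] [lT qT] x; apply/eqP; rewrite -subr_eq0; apply/eqP.
apply: (quad_form_eq0 (dot := dot) (T := fun x => S x - T x)) => [a u v|u].
  by rewrite lS lT scalerBr opprD addrACA.
by rewrite dotBl qS qT subrr.
Qed.

Lemma is_calc_lin a f g S T : bmf f -> bmf g -> is_calc f S -> is_calc g T ->
  is_calc (fun l => a * f l + g l) (fun x => a%:C%C *: S x + T x).
Proof.
move=> bf bg [lS qS] [lT qT]; split=> [b u v|x].
  rewrite lS lT !scalerDr !scalerA [a%:C%C * b]mulrC.
  by rewrite !addrA; congr (_ + _); rewrite -!addrA; congr (_ + _);
    rewrite addrC.
by rewrite dotDl dotZl qS qT (sint_lin dot_norm pvmE)// rmorphD rmorphM.
Qed.

Lemma is_calc_bound f T M : bmf f -> is_calc f T -> (forall l, `|f l| <= M) ->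
  forall x, rnorm (T x) <= M * rnorm x.
Proof.
move=> bf [lT qT] fM; apply: (bounded_quad_form dot_norm lT qT) => x.
exact: (sint_bound dot_norm pvmE).
Qed.

Lemma is_calc_indic B : measurable B -> is_calc \1_B (E B).
Proof.
move=> mB; split; first exact: (pvm_linear pvmE).
by move=> x; rewrite (sint_indic dot_norm pvmE)// (dot_pvm dot_norm pvmE).
Qed.

Lemma is_calcB f g S T : bmf f -> bmf g -> is_calc f S -> is_calc g T ->
  is_calc (fun l => f l - g l) (fun x => S x - T x).
Proof.
move=> bf bg cS cT; have := is_calc_lin (-1) bg bf cT cS.
congr is_calc; apply/funext => l; first by rewrite mulN1r addrC.
by rewrite rmorphN1 scaleN1r addrC.
Qed.

(** In the limit case [is_calc_bound] makes [Tn n x] Cauchy with rate [2 |x| / (m + 1)]; the form of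
    the limit is controlled by Cauchy-Schwarz. *)
Lemma ex_calc f : bmf f -> exists T, is_calc f T.
Proof.
move: f; apply: (@bmf_ind R (fun f => exists T, is_calc f T)) =>
  [B mB|a f g bf bg [S cS] [T cT]|f fn bf bfn ex_fn ffn].
- by exists (E B); exact: is_calc_indic.
- by exists (fun x => a%:C%C *: S x + T x); exact: is_calc_lin.
have /choice[Tn cTn] := ex_fn.
have cvT x : cvg (Tn n x @[n --> \oo]).
  apply: (@rnorm_complete _ _ _ (fun n => (2 * rnorm x) * n.+1%:R^-1)).
    rewrite -(mulr0 (2 * rnorm x)); apply: cvgMr; exact: cvg_harmonic.
  move=> m n mn; rewrite mulrAC.
  apply: (is_calc_bound _ (is_calcB (bfn m) (bfn n) (cTn m) (cTn n))).
    by apply: bmfD => //; under eq_fun do rewrite -mulN1r; exact: bmfZ.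
  move=> l; have := ffn m l; have := ffn n l.
  have : n.+1%:R^-1 <= m.+1%:R^-1 :> R by rewrite lef_pV2 ?posrE ?ltr0n//
    ler_nat.
  rewrite !ler_norml => h /andP[h1 h2] /andP[h3 h4].
  move: (m.+1%:R^-1) (n.+1%:R^-1) h h1 h2 h3 h4 => a b h h1 h2 h3 h4.
  by apply/andP; split; lra.
pose T x := lim (Tn n x @[n --> \oo]).
exists T; split=> [a x y|x].
  apply/cvg_lim; first exact: norm_hausdorff.
  under eq_fun do rewrite (cTn _).1.
  by apply: cvgD; [apply: cvgZr; exact: cvT|exact: cvT].
have approx e : 0 < e -> exists n, rnorm (T x - Tn n x) < e /\ n.+1%:R^-1 < e.
  move=> e0; have /rnorm_cvgP/(_ _ e0) h1 := cvT x.
  have /cvgrPdist_lt/(_ _ e0) h2 := @cvg_harmonic R.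
  have [n []] := filter_ex (filterI h1 h2).
  move=> h3 /=; rewrite sub0r normrN ger0_norm ?invr_ge0 ?ler0n// => h4.
  by exists n.
(* A generic [s] serves both the real part and the imaginary part, which has to vanish. *)
have close (s : R[i] -> R) : (forall u, `|s (dot u x)| <= rnorm u * rnorm x) ->
    (forall a b, s (a - b) = s a - s b) ->
    (forall n, `|s (dot (Tn n x) x) - s (sint x f)%:C%C| <= n.+1%:R^-1 * rnorm
      x ^+ 2) ->
    s (dot (T x) x) = s (sint x f)%:C%C.
  move=> s_le sB sn; apply/eqP; rewrite -subr_eq0 -normr_le0.
  apply/ler_addgt0Pr => e e0; rewrite add0r.
  pose K := rnorm x + rnorm x ^+ 2 + 1.
  have K0 : 0 < K by rewrite ltr_wpDl// addr_ge0 ?rnorm_ge0 ?sqr_ge0.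
  have [n [h1 h2]] := approx _ (divr_gt0 e0 K0).
  have -> : s (dot (T x) x) - s (sint x f)%:C%C =
     s (dot (T x - Tn n x) x) + (s (dot (Tn n x) x) - s (sint x f)%:C%C).
    by rewrite dotBl sB addrA subrK.
  apply: (le_trans (ler_normD _ _)).
  have a1 := s_le (T x - Tn n x).
  have a2 : rnorm (T x - Tn n x) * rnorm x <= e / K * rnorm x.
    by rewrite ler_wpM2r ?rnorm_ge0// ltW.
  have a3 : n.+1%:R^-1 * rnorm x ^+ 2 <= e / K * rnorm x ^+ 2.
    by rewrite ler_wpM2r ?sqr_ge0// ltW.
  have a4 := sn n.
  have a5 : e / K * rnorm x + e / K * rnorm x ^+ 2 + e / K = e.
    have dK : e / K * K = e by rewrite divfK// gt_eqF.
    by rewrite -[RHS]dK; move: (e / K) => d; rewrite /K; ring.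
  have a6 : 0 <= e / K by rewrite divr_ge0// ltW.
  apply: (le_trans (lerD (le_trans a1 a2) (le_trans a4 a3))).
  by rewrite -[X in _ <= X]a5 lerDl.
apply/eqP; rewrite eq_complex; apply/andP; split; apply/eqP.
  apply: (close (@complex.Re R)) => [u|a b|n]; first exact: abs_Re_dot_le.
    by case: a; case: b.
  rewrite (cTn n).2 /= -(sintB dot_norm pvmE)//.
  apply: (sint_bound dot_norm pvmE) => [|l]; last by rewrite distrC.
  by apply: bmfD => //; under eq_fun do rewrite -mulN1r; exact: bmfZ.
apply: (close (@complex.Im R)) => [u|a b|n]; first exact: abs_Im_dot_le.
    by case: a; case: b.
by rewrite (cTn n).2 /= subrr normr0 mulr_ge0 ?invr_ge0 ?sqr_ge0.
Qed.

Definition calc f : H -> H := xget (fun=> 0) [set T | is_calc f T].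

Lemma calcP f : bmf f -> is_calc f (calc f).
Proof. by move=> bf; rewrite /calc; case: xgetP => // h;
  have [T /h] := ex_calc bf. Qed.

Lemma calcE f T : bmf f -> is_calc f T -> calc f =1 T.
Proof. by move=> bf; exact: is_calc_uniq (calcP bf). Qed.

Lemma calc_linear f : bmf f -> linear (calc f).
Proof. by move=> /calcP[]. Qed.

Lemma calc_sym f x y : bmf f -> dot (calc f x) y = dot x (calc f y).
Proof. by move=> /calcP[lf qf]; exact: (real_quad_form_symmetric lf qf). Qed.

Lemma dot_calc f x : bmf f -> dot (calc f x) x = (sint x f)%:C%C.
Proof. by move=> /calcP[]. Qed.

Lemma calc_bound f M x : bmf f -> (forall l, `|f l| <= M) ->
  rnorm (calc f x) <= M * rnorm x.
Proof. by move=> bf fM; exact: (is_calc_bound bf (calcP bf)). Qed.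

Lemma calc_indic B x : measurable B -> calc \1_B x = E B x.
Proof. by move=> mB; apply: calcE; [exact: bmf_indic|exact: is_calc_indic]. Qed.

Lemma calc_lin a f g x : bmf f -> bmf g ->
  calc (fun l => a * f l + g l) x = a%:C%C *: calc f x + calc g x.
Proof.
move=> bf bg; apply: (@calcE _ (fun x => a%:C%C *: calc f x + calc g x)).
  by apply: bmfD => //; exact: bmfZ.
by apply: is_calc_lin => //; exact: calcP.
Qed.

Lemma bmfB f g : bmf f -> bmf g -> bmf (fun l => f l - g l).
Proof.
by move=> bf bg; apply: bmfD => //; under eq_fun do rewrite -mulN1r;
  exact: bmfZ.
Qed.

Lemma calcB f g x : bmf f -> bmf g ->
  calc (fun l => f l - g l) x = calc f x - calc g x.
Proof.
move=> bf bg; apply: (@calcE _ (fun x => calc f x - calc g x)).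
  exact: bmfB.
by apply: is_calcB => //; exact: calcP.
Qed.

(** With [g] fixed, both sides are linear in [f] and continuous under uniform limits. *)
Let calcM_ind g : bmf g ->
  (forall B x, measurable B -> calc (fun l =>
    \1_B l * g l) x = E B (calc g x)) ->
  forall f, bmf f -> forall x, calc (fun l => f l * g l) x = calc f (calc g x).
Proof.
move=> bg base; apply: (@bmf_ind R (fun f => forall x,
  calc (fun l => f l * g l) x = calc f (calc g x))) =>
    [B mB x|a f h bf bh Qf Qh x|].
- by rewrite base// calc_indic.
- rewrite calc_lin// -Qf -Qh -calc_lin; [|exact: bmfM..].
  by congr calc; apply/funext => l; ring.
move=> f fn bf bfn Qfn ffn x; apply/eqP; rewrite -subr_eq0; apply/eqP.
have [mg [M gM]] := bg.
(* The two terms come from [((f - fn) g)(A) x] and from [(f - fn)(A)] applied to [g(A) x]. *)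
apply: (@rnorm_vanish _ _ _ (M * rnorm x + rnorm (calc g x))) => n.
have -> : calc (fun l => f l * g l) x - calc f (calc g x) =
    calc (fun l => (f l - fn n l) * g l) x -
    calc (fun l => f l - fn n l) (calc g x).
  have -> : (fun l => (f l - fn n l) * g l) = (fun l =>
    f l * g l - fn n l * g l).
    by apply/funext => l; ring.
  rewrite !calcB//; [|exact: bmfM..].
  by rewrite Qfn opprB addrA subrK.
apply: (le_trans (rnormD _ _)); rewrite rnormN mulrDl lerD//.
  rewrite mulrAC; apply: calc_bound; first by apply: bmfM => //; exact: bmfB.
  by move=> l; rewrite normrM mulrC ler_pM.
by rewrite mulrC; apply: calc_bound => //; exact: bmfB.
Qed.

(* Taking adjoints swaps the two factors, so that two successive inductions reduce
   the claim to indicator functions. *)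
Lemma calcM f g x : bmf f -> bmf g ->
  calc (fun l => f l * g l) x = calc f (calc g x).
Proof.
have flip f1 g1 : bmf f1 -> bmf g1 ->
    (forall x, calc (fun l => f1 l * g1 l) x = calc f1 (calc g1 x)) ->
    forall x, calc (fun l => g1 l * f1 l) x = calc g1 (calc f1 x).
  move=> bf bg Q y; apply: (@is_calc_uniq (fun l => g1 l * f1 l) _ (fun y =>
    calc g1 (calc f1 y))).
    by apply: calcP; exact: bmfM.
  split=> [a u v|u]; first by rewrite (calc_linear bf) (calc_linear bg).
  rewrite !calc_sym// -Q -calc_sym; last exact: bmfM.
  rewrite dot_calc; last exact: bmfM.
  by congr (sint _ _)%:C%C; apply/funext => l; rewrite mulrC.
move=> bf bg; apply: calcM_ind => // B {}x mB.
have b1 := bmf_indic mB.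
rewrite -calc_indic//; apply: flip => // {}x.
apply: calcM_ind => // C {}x mC.
rewrite calc_indic// -(pvmI pvmE)// -calc_indic; last exact: measurableI.
by congr calc; apply/funext => l; rewrite indicI.
Qed.

Lemma calcC f g x : bmf f -> bmf g -> calc f (calc g x) = calc g (calc f x).
Proof.
move=> bf bg; rewrite -!calcM//.
by congr calc; apply/funext => l; rewrite mulrC.
Qed.

Lemma calc_pvmC B f x : measurable B -> bmf f -> calc f (E B x) = E B (calc f
  x).
Proof. by move=> mB bf; rewrite -!calc_indic// calcC//; exact: bmf_indic. Qed.

Lemma rnorm_calc f x : bmf f -> rnorm (calc f x) ^+ 2 = sint x (fun l =>
  f l ^+ 2).
Proof.
move=> bf; apply: (@complexI R);
  rewrite -(dot_rnorm dot_norm) calc_sym// -calcM//.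
rewrite -calc_sym; last exact: bmfM.
by rewrite dot_calc//; exact: bmfM.
Qed.

(* The norm of [h(A) x] for the complex function [h = f + i g]. *)
Lemma rnorm_calc_complex f g x : bmf f -> bmf g ->
  rnorm (calc f x + 'i%C *: calc g x) ^+ 2 =
  sint x (fun l => f l ^+ 2 + g l ^+ 2).
Proof.
move=> bf bg; rewrite (rnormDsq dot_norm) rnormZ normc_def/=.
rewrite expr0n expr1n add0r sqrtr1 mul1r.
(* The cross term is [-i] times the real number [sint x (f g)]. *)
have -> : complex.Re (dot (calc f x) ('i%C *: calc g x)) = 0.
  rewrite dotZr conjc_i -calc_sym// -calcM// dot_calc; last exact: bmfM.
  by rewrite /= oppr0 mul0r mulr0 subr0.
rewrite mulr0 addr0 !rnorm_calc// -(sintD dot_norm pvmE)//.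
  exact: (@bmfM _ f f).
exact: (@bmfM _ g g).
Qed.

End functional_calculus.

(** * The unitary group *)

Section trigonometric_bounds.
Context {R : realType}.
Implicit Types x y : R.

Lemma mean_value_le (f df : R -> R) (M x : R) :
  (forall y, is_derive y 1 f (df y)) ->
  (forall y, `|y| <= `|x| -> `|df y| <= M) -> `|f x - f 0| <= M * `|x|.
Proof.
move=> fdf dfM.
have cf : continuous f.
  by move=> y; apply/differentiable_continuous/derivable1_diffP;
    have [] := fdf y.
have [x0|x0] := leP 0 x.
  have [c cx ->] := @MVT_segment _ f df 0 x x0 (fun y _ => fdf y)
    (continuous_subspaceT cf).
  rewrite subr0 normrM ler_wpM2r// dfM//; move: cx;
    rewrite in_itv/= => /andP[c0 cx].
  by rewrite !ger0_norm.
have [c cx] := @MVT_segment _ f df x 0 (ltW x0) (fun y _ => fdf y)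
  (continuous_subspaceT cf).
rewrite sub0r distrC => ->; rewrite normrM normrN ler_wpM2r// dfM//.
move: cx; rewrite in_itv/= => /andP[xc c0].
by rewrite !ler0_norm ?lerN2// ltW.
Qed.

Lemma abs_sin_le x : `|sin x| <= `|x|.
Proof.
have := @mean_value_le sin cos 1 x (@is_derive_sin R).
by rewrite sin0 subr0 mul1r; apply => y _; exact: cos_max.
Qed.

Lemma abs_cosB1_le x : `|cos x - 1| <= `|x|.
Proof.
have := @mean_value_le cos (fun y => - sin y) 1 x (@is_derive_cos R).
by rewrite cos0 mul1r; apply => y _; rewrite normrN; exact: sin_max.
Qed.

(** The derivative is at most [|y| <= |x|] on the segment; the factor 1/2 of the Taylor bound is
    given up. *)
Lemma abs_cosB1_le_sqr x : `|cos x - 1| <= x ^+ 2.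
Proof.
have := @mean_value_le cos (fun y => - sin y) `|x| x (@is_derive_cos R).
rewrite cos0 -normrM -expr2 (ger0_norm (sqr_ge0 x)); apply => y yx.
by rewrite normrN (le_trans (abs_sin_le y)).
Qed.

Lemma abs_sinB_le_sqr x : `|sin x - x| <= x ^+ 2.
Proof.
have := @mean_value_le (fun y => sin y - y) (fun y => cos y - 1) `|x| x.
rewrite sin0 !subr0 -normrM -expr2 (ger0_norm (sqr_ge0 x)); apply => y yx.
by rewrite (le_trans (abs_cosB1_le y)).
Qed.

End trigonometric_bounds.

Lemma ler_of_sqr {R : realType} (a b : R) : 0 <= b -> a ^+ 2 <= b ^+ 2 -> a <=
  b.
Proof.
move=> b0 ab; have [a0|a0] := leP 0 a; last exact: le_trans (ltW a0) b0.
by rewrite -(ler_pXn2r (n := 2)).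
Qed.

Lemma sqr_normr {R : realDomainType} (x : R) : `|x| ^+ 2 = x ^+ 2.
Proof. by rewrite real_normK// num_real. Qed.

Section unitary_group.
Context {R : realType} {H : completeNormedModType R[i]}.
Context (dot : {dot H for Num.conj}).
Context (dot_norm : forall x : H, `|x| ^+ 2 = dot x x).
Context (E : set (measurableTypeR R) -> H -> H).
Context (pvmE : projection_valued_measure dot E).
Implicit Types (x y z : H) (a b s t : R).

Local Notation calc := (calc dot E).
Local Notation sint := (@sint R H E).
Local Notation U := (expi dot E).
Local Notation P a := (E `[- a, a]%classic).
Local Notation ind a := (\1_(`[- a, a]%classic) : measurableTypeR R -> R).
Local Notation cosm t := ((fun l => cos (t * l)) : measurableTypeR R -> R).
Local Notation sinm t := ((fun l => sin (t * l)) : measurableTypeR R -> R).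

Lemma bmf_cos t : bmf (cosm t).
Proof.
split; last by exists 1 => l; exact: cos_max.
apply: continuous_measurable_fun => l; apply: continuous_comp;
  last exact: continuous_cos.
exact: mulrl_continuous.
Qed.

Lemma bmf_sin t : bmf (sinm t).
Proof.
split; last by exists 1 => l; exact: sin_max.
apply: continuous_measurable_fun => l; apply: continuous_comp;
  last exact: continuous_sin.
exact: mulrl_continuous.
Qed.

#[local] Hint Resolve bmf_cos bmf_sin : core.

Let mP a : measurable (`[- a, a]%classic : set (measurableTypeR R)).
Proof. exact: measurable_itv. Qed.

Let bind a : bmf (ind a).
Proof. exact/bmf_indic. Qed.

Lemma calc_cst (c : R) x : calc (fun=> c) x = c%:C%C *: x.
Proof.
suff h : is_calc dot E (fun=> c) (fun x => c%:C%C *: x).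
  exact: (calcE dot_norm pvmE (bmf_cst c) h).
split=> [a u v|u]; first by rewrite /= scalerDr !scalerA [c%:C%C * a]mulrC.
by rewrite dotZl (dot_rnorm dot_norm) (sint_cst dot_norm pvmE) -rmorphM.
Qed.

(** [expi] is chosen among the bounded operators with a given form; there is at most one, and the
    right-hand side is one. *)
Lemma expiE t x : U t x = calc (cosm t) x + 'i%C *: calc (sinm t) x.
Proof.
pose V x := calc (cosm t) x + 'i%C *: calc (sinm t) x.
have spU T T' : is_spectral_integral dot E (fun l =>
  (cos (t * l) +i* sin (t * l))%C) T ->
  is_spectral_integral dot E (fun l =>
    (cos (t * l) +i* sin (t * l))%C) T' -> T =1 T'.
  move=> [[lT _] qT] [[lT' _] qT'] y; apply/eqP; rewrite -subr_eq0; apply/eqP.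
  apply: (quad_form_eq0 (dot := dot) (T := fun x => T x - T' x)) => [a u v|u].
    by rewrite lT lT' scalerBr opprD addrACA.
  by rewrite dotBl qT qT' subrr.
have spV : is_spectral_integral dot E (fun l =>
  (cos (t * l) +i* sin (t * l))%C) V.
  split; first split.
  - move=> a u v; rewrite /V !(calc_linear dot_norm pvmE)// !scalerDr !scalerA.
    by rewrite ['i%C * a]mulrC addrACA.
  - exists 2 => u; apply: (le_trans (rnormD _ _)).
    rewrite rnormZ normc_def/= expr0n expr1n add0r sqrtr1 mul1r.
    have -> : 2 * rnorm u = 1 * rnorm u + 1 * rnorm u by ring.
    by apply: lerD; apply: (calc_bound dot_norm pvmE) => // l;
      [exact: cos_max|exact: sin_max].
  move=> u; rewrite /V dotDl dotZl !(dot_calc dot_norm pvmE)//.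
  by apply/eqP; rewrite eq_complex/= !(mul0r, mul1r, mulr0, subr0, subrr,
    addr0, add0r) !eqxx.
by rewrite /expi /spectral_integral; case: xgetP => [T _ hT|/(_ V)//];
  exact: (spU T V).
Qed.

Lemma expi_linear t : linear (U t).
Proof.
move=> a u v; rewrite !expiE !(calc_linear dot_norm pvmE)// !scalerDr !scalerA.
by rewrite ['i%C * a]mulrC addrACA.
Qed.

Lemma rnorm_expi t x : rnorm (U t x) = rnorm x.
Proof.
apply/eqP; rewrite -(eqrXn2 (n := 2))// ?rnorm_ge0//; apply/eqP.
rewrite expiE (rnorm_calc_complex dot_norm pvmE)// -[RHS]mul1r.
rewrite -(sint_cst dot_norm pvmE).
by congr (sint _ _); apply/funext => l; rewrite cos2Dsin2.
Qed.

Lemma expiD s t x : U (s + t) x = U s (U t x).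
Proof.
rewrite !expiE !(linear_mapD (calc_linear dot_norm pvmE (bmf_cos s))).
rewrite !(linear_mapD (calc_linear dot_norm pvmE (bmf_sin s))).
rewrite !(linear_mapZ (calc_linear dot_norm pvmE (bmf_cos s))).
rewrite !(linear_mapZ (calc_linear dot_norm pvmE (bmf_sin s))).
rewrite -!(calcM dot_norm pvmE)//.
have -> : cosm (s + t) =
    (fun l => (cos (s * l) * cos (t * l)) - (sin (s * l) * sin (t * l))).
  by apply/funext => l; rewrite mulrDl cosD.
have -> : sinm (s + t) =
    (fun l => (1 * (sin (s * l) * cos (t * l))) + (cos (s * l) * sin (t * l))).
  by apply/funext => l; rewrite mulrDl sinD mul1r.
rewrite (calcB dot_norm pvmE); [|exact: bmfM..].
rewrite (calc_lin dot_norm pvmE); [|exact: bmfM..].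
have ii : 'i%C * 'i%C = -1 :> R[i].
  by apply/eqP; rewrite eq_complex/= !mul0r !mulr0 mul1r sub0r addr0 oppr0
    !eqxx.
rewrite !scalerDr !scalerA ii mulr1 scaleN1r.
by rewrite -!addrA; congr (_ + _);
  rewrite [LHS]addrC [RHS]addrA [X in X - _]addrC.
Qed.

Lemma expi0 x : U 0 x = x.
Proof.
rewrite expiE.
have -> : cosm 0 = fun=> 1 by apply/funext => l; rewrite mul0r cos0.
have -> : sinm 0 = fun=> 0 by apply/funext => l; rewrite mul0r sin0.
by rewrite !calc_cst scale1r scale0r scaler0 addr0.
Qed.

Lemma expi_pvmC B t x : measurable B -> U t (E B x) = E B (U t x).
Proof.
move=> mB; have lB := pvm_linear pvmE mB.
by rewrite !expiE (linear_mapD lB) (linear_mapZ lB) !(calc_pvmC dot_norm pvmE).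
Qed.

Lemma pvm_segment_le a b x : a <= b -> P b (P a x) = P a x.
Proof.
move=> ab; rewrite -(pvmI pvmE)//; congr (E _ _).
apply/seteqP; split=> l /=; rewrite !in_itv/=; first by case.
by move=> /andP[h1 h2]; split; apply/andP; split; lra.
Qed.

Lemma pvm_segment_ge a b x : a <= b -> P a (P b x) = P a x.
Proof. by move=> ab; rewrite (pvmC pvmE)// pvm_segment_le. Qed.

End unitary_group.

(** * The operator A on spectral subspaces *)

Section self_adjoint_calculus.
Context {R : realType} {H : completeNormedModType R[i]}.
Context (dot : {dot H for Num.conj}).
Context (dot_norm : forall x : H, `|x| ^+ 2 = dot x x).
Context (A : partial_op H).
Context (saA : self_adjoint dot A).
Context (E : set (measurableTypeR R) -> H -> H).
Context (specE : spectral_measure_of dot A E).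
Implicit Types (x y z : H) (a b s t : R).

Let pvmE : projection_valued_measure dot E.
Proof. by case: specE. Qed.

Local Notation calc := (calc dot E).
Local Notation sint := (@sint R H E).
Local Notation U := (expi dot E).
Local Notation P a := (E `[- a, a]%classic).
Local Notation ind a := (\1_(`[- a, a]%classic) : measurableTypeR R -> R).
Local Notation lam a := ((fun l =>
  l * \1_(`[- a, a]%classic) l) : measurableTypeR R -> R).

Let mP a : measurable (`[- a, a]%classic : set (measurableTypeR R)).
Proof. exact: measurable_itv. Qed.

Let bind a : bmf (ind a).
Proof. exact/bmf_indic. Qed.

Let lP a : linear (P a).
Proof. exact: (pvm_linear pvmE). Qed.

Let in_seg a (l : R) : (l \in (`[- a, a]%classic : set R)) = (`|l| <= a).
Proof. by rewrite ler_norml; apply/idP/idP; rewrite inE /= in_itv. Qed.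

Lemma bmf_lam a : bmf (lam a).
Proof.
split; first by apply: measurable_funM => //; exact: measurable_indic.
exists `|a| => l; rewrite indicE in_seg; case: (leP `|l| a) => [la|_].
  by rewrite mulr1 (le_trans la)// ler_norm.
by rewrite mulr0 normr0.
Qed.

Lemma sa_linear : linear_op A.
Proof. by case: saA. Qed.

Lemma sa_sym x y : dom A x -> dom A y -> dot (A x) y = dot x (A y).
Proof. by case: saA => _ _ /(_ y (A y)) [_ h] dx dy; apply: h. Qed.

Lemma sa_dom0 : dom A 0.
Proof. by case: sa_linear => -[]. Qed.

Lemma sa_domB x y : dom A x -> dom A y -> dom A (x - y).
Proof.
by move=> dx dy; case: sa_linear => -[_ /(_ (-1) y x dy dx)];
  rewrite scaleN1r addrC.
Qed.

Lemma sa_B x y : dom A x -> dom A y -> A (x - y) = A x - A y.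
Proof.
move=> dx dy; case: sa_linear => -[_ _] /(_ (-1) y x dy dx).
by rewrite !scaleN1r addrC => ->; rewrite addrC.
Qed.

Lemma pvm_segmentC_eq0 a x : E (~` `[- a, a]%classic) (P a x) = 0.
Proof.
rewrite -(pvmI pvmE)//; last exact: measurableC.
by rewrite setICl (pvm0 pvmE).
Qed.

(** The scalar measure of [P a x] is carried by [-a, a], where [l ^+ 2] agrees with a bounded
    function. *)
Lemma dom_segment a x : dom A (P a x).
Proof.
case: specE => _ domA _; apply/domA.
have bl2 : bmf (fun l => lam a l ^+ 2) by exact: (bmfM (bmf_lam a) (bmf_lam a)).
rewrite (@eq_integral_supp _ _ _ dot_norm _ pvmE _ `[- a, a]%classic _ (fun l
  => lam a l ^+ 2))//.
- by rewrite (integral_bmf dot_norm pvmE)// ltry.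
- by case: bl2.
- exact: pvm_segmentC_eq0.
- by move=> l; rewrite /= indicE => la; rewrite mem_set// mulr1.
Qed.

Let PAP a x : P a (A (P a x)) = calc (lam a) x.
Proof.
have bl := bmf_lam a.
suff h : is_calc dot E (lam a) (fun x => P a (A (P a x))).
  by rewrite (calcE dot_norm pvmE bl h).
split=> [c u v|u].
  by rewrite lP (sa_linear.2 c) ?lP//; exact: dom_segment.
rewrite (pvm_sym pvmE)//; case: specE => _ _ ->; last exact: dom_segment.
rewrite (@eq_integral_supp _ _ _ dot_norm _ pvmE _ `[- a, a]%classic _ (lam
  a))//.
- rewrite -/(sint (P a u) _) -(dot_calc dot_norm pvmE (P a u) bl) -(pvm_sym
  pvmE)//.
  rewrite -!(calc_indic dot_norm pvmE)// -!(calcM dot_norm pvmE)//;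
    last exact: bmfM.
  rewrite (dot_calc dot_norm pvmE); last by apply: bmfM => //; exact: bmfM.
  congr (sint _ _)%:C%C; apply/funext => l; rewrite !indicE.
  by case: (_ \in _); rewrite ?mulr1 ?mul1r ?mulr0.
- by case: bl.
- exact: pvm_segmentC_eq0.
- by move=> l /= la; rewrite indicE mem_set// mulr1.
Qed.

(** Strong convergence of [P n] to the identity reduces estimates to spectral subspaces, where the
    bounded calculus applies. *)
Lemma rnorm_segment_lim x (c : R) (N0 : nat) :
  (forall n, (N0 <= n)%N -> rnorm (P n%:R x) <= c) -> rnorm x <= c.
Proof.
move=> Pc; apply/ler_addgt0Pr => e e0.
have [N _ NP] := pvm_segment_cvg dot_norm pvmE x e0.
have h := Pc (maxn N N0) (leq_maxr _ _); have h' := NP _ (leq_maxl N N0).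
rewrite -(subrK (P (maxn N N0)%:R x) x) addrC.
by apply: (le_trans (rnormD _ _)); rewrite lerD// ltW.
Qed.

(* The quadratic form of A on the range of P_a only yields the compression
   P_a A P_a; comparing the compressions to P_a and to P_n for all n >= a
   removes the outer projection. *)
Lemma app_segment a x : A (P a x) = calc (lam a) x.
Proof.
apply/eqP; rewrite -subr_eq0; apply/eqP; set v := _ - _.
apply/rnorm0_eq0/eqP; rewrite eq_le rnorm_ge0 andbT.
apply: (@rnorm_segment_lim _ _ (Num.trunc `|a|).+1) => n an.
have ab : a <= n%:R.
  apply: le_trans (ler_norm a) _; apply: ltW.
  by apply: lt_le_trans (truncnS_gt _) _; rewrite ler_nat.
suff -> : P n%:R v = 0 by rewrite rnorm0.
rewrite /v (linear_mapB (@lP n%:R)) -{1}(pvm_segment_le pvmE x ab) PAP.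
apply/eqP; rewrite subr_eq0; apply/eqP.
have bl k := bmf_lam k.
rewrite -!(calc_indic dot_norm pvmE)// -!(calcM dot_norm pvmE)//.
congr (calc _ _); apply/funext => l; rewrite /= !indicE !in_seg.
have [la|] := leP `|l| a; last by rewrite !mulr0.
by rewrite (le_trans la ab) mulr1 mul1r.
Qed.

(** [A P_a] is bounded and symmetric, so [<P_a A x, v> = <x, A P_a v> = <A P_a x, v>]; taking for
    [v] the difference of the two sides gives [<v, v> = 0]. *)
Lemma segment_appC a x : dom A x -> P a (A x) = A (P a x).
Proof.
move=> dx; apply/eqP; rewrite -subr_eq0; apply/eqP; set v := _ - _.
apply/eqP; rewrite -(dnorm_eq0 dot); apply/eqP.
rewrite {1}/v dotBl (pvm_sym pvmE)// sa_sym//; last exact: dom_segment.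
rewrite !app_segment -(calc_sym dot_norm pvmE) ?subrr//.
exact: bmf_lam.
Qed.

Lemma rnorm_app_segment_le a x : 0 <= a -> rnorm (A (P a x)) <= a * rnorm x.
Proof.
move=> a0; rewrite app_segment; apply: (calc_bound dot_norm pvmE) => [|l].
  exact: bmf_lam.
by rewrite indicE in_seg; case: (leP `|l| a); rewrite ?mulr1// mulr0 normr0.
Qed.

(** Integrate [a^2 (1_[-n,n] - 1_[-a,a]) <= l^2 1_[-n,n]] against the measure of [z], which gives no
    mass to [-a, a], and let [n] grow. *)
Lemma rnorm_app_off_segment a z : 0 <= a -> dom A z -> P a z = 0 ->
  a * rnorm z <= rnorm (A z).
Proof.
move=> a0 dz Paz.
move: a0; rewrite le_eqVlt => /predU1P[<-|a0]; first by rewrite mul0r rnorm_ge0.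
rewrite mulrC -ler_pdivlMr//.
apply: (@rnorm_segment_lim _ _ (Num.trunc a).+1) => n an.
have {}an : a <= n%:R.
  by apply: ltW; apply: lt_le_trans (truncnS_gt _) _; rewrite ler_nat.
rewrite ler_pdivlMr//; apply: le_trans (rnorm_pvm_le dot_norm pvmE _ (mP n%:R)).
rewrite segment_appC//; apply: ler_of_sqr; first exact: rnorm_ge0.
have bB : bmf (fun l => ind n%:R l - ind a l) by exact: bmfB.
have -> : (rnorm (P n%:R z) * a) ^+ 2 =
    sint z (fun l => a ^+ 2 * (ind n%:R l - ind a l)).
  rewrite (sintZ dot_norm pvmE)// (sintB dot_norm pvmE)//.
  by rewrite !(sint_indic dot_norm pvmE)// Paz rnorm0 expr0n subr0 mulrC exprMn.
rewrite app_segment (rnorm_calc dot_norm pvmE); last exact: bmf_lam.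
apply: (le_sint dot_norm pvmE);
  [exact: bmfZ|exact: (bmfM (bmf_lam _) (bmf_lam _))|].
move=> l; rewrite !indicE !in_seg; have [la|la] := leP `|l| a.
  by rewrite (le_trans la an) subrr mulr0 sqr_ge0.
case: (leP `|l| n%:R) => _; last by rewrite subrr mulr0 sqr_ge0.
by rewrite subr0 !mulr1 -(sqr_normr l) ler_pXn2r ?nnegrE//; exact: ltW.
Qed.

Let calc_le f g (h : measurableTypeR R -> R) (M : R) z : bmf f -> bmf g -> bmf
  h ->
  0 <= M -> (forall l, f l ^+ 2 + g l ^+ 2 <= M ^+ 2 * h l ^+ 2) ->
  rnorm (calc f z + 'i%C *: calc g z) <= M * rnorm (calc h z).
Proof.
move=> bf bg bh M0 fgh; apply: ler_of_sqr; first by rewrite mulr_ge0 ?rnorm_ge0.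
have b2 k : bmf k -> bmf (fun l => k l ^+ 2) by move=> bk; exact: (bmfM bk bk).
rewrite (rnorm_calc_complex dot_norm pvmE)// exprMn (rnorm_calc dot_norm
  pvmE)//.
rewrite -(sintZ dot_norm pvmE); last exact: b2.
apply: (le_sint dot_norm pvmE) => //.
  by apply: bmfD; exact: b2.
by apply: bmfZ; exact: b2.
Qed.

Local Notation fcos t a := ((fun l =>
  (cos (t * l) - 1) * \1_(`[- a, a]%classic) l)
  : measurableTypeR R -> R).
Local Notation fsin t a := ((fun l => sin (t * l) * \1_(`[- a, a]%classic) l)
  : measurableTypeR R -> R).

Let bfcos t a : bmf (fcos t a).
Proof. by apply: bmfM => //; apply: bmfD; [exact: bmf_cos|exact: bmf_cst]. Qed.

Let bfsin t a : bmf (fsin t a).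
Proof. by apply: bmfM => //; exact: bmf_sin. Qed.

Let expiB1 t a z :
  U t (P a z) - P a z = calc (fcos t a) z + 'i%C *: calc (fsin t a) z.
Proof.
rewrite (expiE dot_norm pvmE) -(calc_indic dot_norm pvmE)//.
have bB : bmf (fun l => cos (t * l) - 1).
  by apply: bmfD; [exact: bmf_cos|exact: bmf_cst].
rewrite !(calcM dot_norm pvmE)//; last exact: bmf_sin.
rewrite [X in _ = X + _](calcB dot_norm pvmE); [|exact: bmf_cos|exact: bmf_cst].
by rewrite (calc_cst dot_norm pvmE) scale1r addrAC.
Qed.

(** Real and imaginary parts of [e^{itl} - 1] are each at most [|t l|], whence the generous factor
    2. *)
Lemma expi_lipschitz t z : dom A z -> rnorm (U t z - z) <= 2 * `|t| * rnorm (A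
  z).
Proof.
move=> dz; apply: (@rnorm_segment_lim _ _ 0) => n _.
have -> : P n%:R (U t z - z) = U t (P n%:R z) - P n%:R z.
  by rewrite (linear_mapB (@lP n%:R)) (expi_pvmC dot_norm pvmE).
rewrite expiB1.
apply: le_trans (_ : _ <= 2 * `|t| * rnorm (calc (lam n%:R) z)) _.
  apply: calc_le => // [|l]; first exact: bmf_lam.
  rewrite !exprMn -mulrDl [X in _ <= X]mulrA ler_wpM2r ?sqr_ge0//.
  have k1 : (cos (t * l) - 1) ^+ 2 <= (t * l) ^+ 2.
    by rewrite -sqr_normr -[leRHS]sqr_normr ler_pXn2r ?nnegrE// abs_cosB1_le.
  have k2 : sin (t * l) ^+ 2 <= (t * l) ^+ 2.
    by rewrite -sqr_normr -[leRHS]sqr_normr ler_pXn2r ?nnegrE// abs_sin_le.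
  have k3 := sqr_ge0 (t * l).
  by rewrite -mulrA sqr_normr -exprMn; lra.
rewrite ler_wpM2l ?mulr_ge0// -app_segment -segment_appC//.
exact: (rnorm_pvm_le dot_norm pvmE).
Qed.

(** On [-a, a] the remainders of cosine and sine are each at most [(t a)^2]. *)
Lemma expi_taylor t a z : 0 <= a ->
  rnorm (U t (P a z) - P a z - ('i * t%:C)%C *: A (P a z)) <=
  2 * (t * a) ^+ 2 * rnorm z.
Proof.
move=> a0; rewrite expiB1 app_segment -scalerA -addrA -scalerBr.
have blt : bmf (fun l => t * lam a l) by apply: bmfZ; exact: bmf_lam.
have -> : t%:C%C *: calc (lam a) z = calc (fun l => t * lam a l) z.
  have := @calc_lin _ _ _ dot_norm _ pvmE t _ _ z (bmf_lam a) (bmf_cst 0).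
  rewrite (calc_cst dot_norm pvmE) scale0r addr0 => <-.
  by congr (calc _ _); apply/funext => l; rewrite addr0.
rewrite -(calcB dot_norm pvmE)//.
apply: le_trans (calc_le (h := fun=> 1) (M := 2 * (t * a) ^+ 2) _ _ _ _ _ _) _.
- exact: bfcos.
- exact: bmfB.
- exact: bmf_cst.
- by rewrite mulr_ge0// sqr_ge0.
- move=> l; rewrite expr1n mulr1 indicE in_seg.
  have [la|_] := leP `|l| a; last first.
    by rewrite !mulr0 subrr expr0n/= addr0 sqr_ge0.
  rewrite !mulr1.
  have h1 := abs_cosB1_le_sqr (t * l); have h2 := abs_sinB_le_sqr (t * l).
  have h3 : (t * l) ^+ 2 <= (t * a) ^+ 2.
    by rewrite !exprMn ler_wpM2l ?sqr_ge0// -(sqr_normr l) ler_pXn2r ?nnegrE.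
  rewrite -(sqr_normr (cos _ - 1)) -(sqr_normr (sin _ - _)).
  have k1 : `|cos (t * l) - 1| ^+ 2 <= (t * a) ^+ 2 ^+ 2.
    by rewrite ler_pXn2r ?nnegrE ?sqr_ge0// (le_trans h1).
  have k2 : `|sin (t * l) - t * l| ^+ 2 <= (t * a) ^+ 2 ^+ 2.
    by rewrite ler_pXn2r ?nnegrE ?sqr_ge0// (le_trans h2).
  have k3 := sqr_ge0 ((t * a) ^+ 2).
  by rewrite [X in _ <= X]exprMn; lra.
by rewrite (calc_cst dot_norm pvmE) scale1r.
Qed.

End self_adjoint_calculus.

(** * Equicontinuity controls spectral truncation *)

Section spectral_truncation.
Context {R : realType} {H : completeNormedModType R[i]}.
Context (dot : {dot H for Num.conj}).
Context (dot_norm : forall x : H, `|x| ^+ 2 = dot x x).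
Context (A : partial_op H).
Context (saA : self_adjoint dot A).
Context (E : set (measurableTypeR R) -> H -> H).
Context (specE : spectral_measure_of dot A E).
Implicit Types (x y z u : H) (a b s t : R).

Let pvmE : projection_valued_measure dot E.
Proof. by case: specE. Qed.

Local Notation U := (expi dot E).
Local Notation P a := (E `[- a, a]%classic).

Let mP a : measurable (`[- a, a]%classic : set (measurableTypeR R)).
Proof. exact: measurable_itv. Qed.

Let lP a : linear (P a).
Proof. exact: (pvm_linear pvmE). Qed.

Lemma rnorm_subP_le a u : rnorm (u - P a u) <= rnorm u.
Proof.
apply: ler_of_sqr; first exact: rnorm_ge0.
by rewrite (rnorm_pvmC dot_norm pvmE)// lerBlDr lerDl sqr_ge0.
Qed.

Lemma rnorm_P_subP_le a b u : rnorm (P b (u - P a u)) <= rnorm u.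
Proof.
exact: le_trans (rnorm_pvm_le dot_norm pvmE _ (mP b)) (rnorm_subP_le _ _).
Qed.

(** [N] times the average, left undivided to keep inverses of [N] out of the estimates. *)
Let sumU (h : R) (N : nat) y := \sum_(k < N) U (h * k%:R) y.

Let sumU_shift h N y : U h (sumU h N y) - sumU h N y = U (h * N%:R) y - y.
Proof.
have lU := expi_linear dot_norm pvmE h.
elim: N => [|N IH].
  by rewrite /sumU big_ord0 (linear_map0 lU) mulr0 (expi0 dot_norm pvmE) !subrr.
rewrite /sumU big_ord_recr/= (linear_mapD lU) opprD addrACA -/(sumU h N y) IH.
rewrite -(expiD dot_norm pvmE).
have -> : h + h * N%:R = h * N.+1%:R by rewrite -natr1 mulrDr mulr1 addrC.
by rewrite addrC addrA subrK.
Qed.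

Let sumU_near h N y e :
  (forall k : nat, (k < N)%N -> rnorm (U (h * k%:R) y - y) <= e) ->
  N%:R * rnorm y <= rnorm (sumU h N y) + N%:R * e.
Proof.
move=> Ue; have yN : rnorm (y *+ N) = N%:R * rnorm y.
  by rewrite -scaler_nat rnormZ normr_nat -(rmorph_nat (real_complex R)).
have : rnorm (sumU h N y - y *+ N) <= N%:R * e.
  elim: N Ue {yN} => [|N IH] Ue.
    by rewrite /sumU big_ord0 mulr0n subrr rnorm0 mul0r.
  rewrite /sumU big_ord_recr/= mulrSr opprD addrACA -natr1 mulrDl mul1r.
  apply: le_trans (rnormD _ _) _; rewrite lerD ?Ue//.
  by apply: IH => k kN; apply: Ue; rewrite ltnS ltnW.
rewrite -yN => h1; have := rnormD (sumU h N y) (y *+ N - sumU h N y).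
by rewrite rnormB_C addrC subrK; lra.
Qed.

(* The averages S = 1/N \sum_(k < N) U_{kh} of y = (P_b - P_a) u, with Nh = d/2,
   stay within e of y; on the other hand (U_h - 1) S y = (U_{d/2} y - y) / N,
     and
   U_h - 1 is bounded below by a h / 2 on the range of P_b - P_a once h is
     small,
   so that |S y| <= |y| / 2. *)
Lemma equicontinuous_truncation u d e a : 0 < d -> 0 < a -> 16 <= d * a ->
  (forall s, `|s| < d -> rnorm (U s u - u) <= e) -> rnorm (u - P a u) <= 2 * e.
Proof.
move=> d0 a0 da Ue.
apply: (rnorm_segment_lim dot_norm specE (N0 := (Num.trunc a).+1)) => n an.
set b : R := n%:R.
have ab : a <= b.
  by apply: ltW; apply: lt_le_trans (truncnS_gt _) _; rewrite ler_nat.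
have b0 : 0 < b by exact: lt_le_trans ab.
set y := P b (u - P a u).
have Pby : P b y = y by rewrite /y (pvm_idem pvmE).
have Pay : P a y = 0.
  rewrite /y (pvm_segment_ge pvmE _ ab) (linear_mapB (@lP a)) (pvm_idem pvmE)//.
  by rewrite subrr.
(* [P b (1 - P a)] is a contraction commuting with [U s], so [y] inherits the hypothesis on [u]. *)
have Uy s : `|s| < d -> rnorm (U s y - y) <= e.
  move=> sd; apply: le_trans (Ue _ sd).
  rewrite -(rnormN (U s u - u)) -(rnormN (U s y - y)).
  have -> : - (U s y - y) = P b (- (U s u - u) - P a (- (U s u - u))).
    rewrite !opprB /y (expi_pvmC dot_norm pvmE)// -(linear_mapB (@lP b));
      congr (P b _).
    have lU := expi_linear dot_norm pvmE s.
    rewrite (linear_mapB lU) (expi_pvmC dot_norm pvmE)// (linear_mapB (@lP a)).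
    by rewrite [in LHS]opprD addrACA -opprD.
  exact: rnorm_P_subP_le.
(* So large that [h = d / 2N] satisfies [4 h b^2 <= a]; the Taylor error [2 (h b)^2 |Z|] is then at
   most half of [h a |Z|]. *)
pose N := (Num.trunc (2 * d * b ^+ 2 / a)).+1.
have N0 : 0 < N%:R :> R by rewrite ltr0n.
pose h := d / 2 / N%:R.
have h0 : 0 < h by rewrite !divr_gt0.
have hN : h * N%:R = d / 2 by rewrite divfK// gt_eqF.
have hb : 4 * h * b ^+ 2 <= a.
  have : 2 * d * b ^+ 2 / a <= N%:R by apply: ltW; exact: truncnS_gt.
  rewrite ler_pdivrMr// => hh.
  rewrite -(ler_pM2r N0).
  have -> : 4 * h * b ^+ 2 * N%:R = 4 * (h * N%:R) * b ^+ 2 by ring.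
  by rewrite hN; lra.
set Z := sumU h N y.
have Zlin Q : linear Q -> (forall t x, U t (Q x) = Q (U t x)) ->
    Q Z = sumU h N (Q y).
  move=> lQ QU; rewrite /Z /sumU; elim: (N) => [|m IH].
    by rewrite !big_ord0 (linear_map0 lQ).
  by rewrite !big_ord_recr/= (linear_mapD lQ) IH QU.
have PbZ : P b Z = Z.
  by rewrite Zlin ?Pby// => t x; exact: (expi_pvmC dot_norm pvmE).
have PaZ : P a Z = 0.
  rewrite Zlin ?Pay//; last by move=> t x; exact: (expi_pvmC dot_norm pvmE).
  rewrite /sumU big1// => k _.
  exact: (linear_map0 (expi_linear dot_norm pvmE _)).
have up : rnorm (U h Z - Z) <= 2 * rnorm y.
  rewrite sumU_shift; apply: le_trans (rnormD _ _) _.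
  by rewrite rnormN (rnorm_expi dot_norm pvmE); lra.
have tay := expi_taylor dot_norm saA specE h Z (ltW b0).
rewrite PbZ in tay.
have dZ : dom A Z by rewrite -PbZ; exact: (dom_segment dot_norm specE).
have low := rnorm_app_off_segment dot_norm saA specE (ltW a0) dZ PaZ.
have iA : rnorm (('i * h%:C)%C *: A Z) = h * rnorm (A Z).
  rewrite rnormZ normrM !normc_def/= expr0n expr1n add0r addr0 sqrtr1.
  by rewrite mulr0 subr0 mul1r sqrtr_sqr (gtr0_norm h0).
have tri : h * rnorm (A Z) <= rnorm (U h Z - Z) + 2 * (h * b) ^+ 2 * rnorm Z.
  rewrite -iA -[_ *: A Z](subrK (U h Z - Z)).
  apply: le_trans (rnormD _ _) _; rewrite addrC lerD2l rnormB_C.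
  exact: tay.
have nearS := sumU_near (N := N) (h := h) (y := y) (e := e).
have yZ : N%:R * rnorm y <= rnorm Z + N%:R * e.
  apply: nearS => k kN; apply: Uy.
  rewrite ger0_norm; last exact: (mulr_ge0 (ltW h0) (ler0n _ _)).
  apply: (@lt_le_trans _ _ (h * N%:R)); first by rewrite ltr_pM2l// ltr_nat.
  by rewrite hN; lra.
have z0 := rnorm_ge0 Z.
have l1 : h * (a * rnorm Z) <= h * rnorm (A Z) by rewrite ler_pM2l.
have l2 : 2 * (h * b) ^+ 2 * rnorm Z <= h * a / 2 * rnorm Z.
  rewrite ler_wpM2r//.
  have : h * (4 * h * b ^+ 2) <= h * a by rewrite ler_pM2l.
  by rewrite exprMn; lra.
have l3 : h * a * rnorm Z <= 4 * rnorm y by lra.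
(* By [16 <= d * a] this is at least 8, hence [|Z| <= N |y| / 2]; together with [N |y| <= |Z| + N e]
   it gives [|y| <= 2 e]. *)
have l4 : h * a * N%:R = d * a / 2.
  by rewrite mulrAC hN; ring.
have l5 : 8 * rnorm Z <= 4 * (N%:R * rnorm y).
  have : (h * a * rnorm Z) * N%:R <= 4 * rnorm y * N%:R by rewrite ler_wpM2r//
    ltW.
  have -> : h * a * rnorm Z * N%:R = (h * a * N%:R) * rnorm Z by ring.
  have : 8 * rnorm Z <= (h * a * N%:R) * rnorm Z.
    by rewrite ler_wpM2r// l4; lra.
  have -> : 4 * rnorm y * N%:R = 4 * (N%:R * rnorm y) by ring.
  exact: le_trans.
have l6 : N%:R * rnorm y <= N%:R * (2 * e).
  by rewrite mulrCA; move: (N%:R * rnorm y) (N%:R * e) yZ l5 => p q *; lra.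
by rewrite ler_pM2l in l6.
Qed.

End spectral_truncation.

(** * Ultrapowers *)

Section ultrapower_representatives.
Context {R : realType} {V : normedModType R[i]} {omega : free_ultrafilter}.
Implicit Types (x y : ultrapower V omega) (u v w : nat -> V).

Local Notation om := (fu_sets omega).

Let ucls_bseq u (ub : u \in @Defs.bseq R V) :
  ucls omega u = (\pi_(Quotient.quot (Tomega omega)) (Linf ub))%qT.
Proof. exact: (ucls_linf omega (Linf ub)). Qed.

Lemma represents_linear (a : R[i]) u v x y : represents u x -> represents v y ->
  represents (fun n => a *: u n + v n) (a *: x + y).
Proof.
move=> [/bseqP ub <-] [/bseqP vb <-].
split; first exact: (linf_bounded (a *: Linf ub + Linf vb)).
transitivity ((\pi_(Quotient.quot (Tomega omega)) (a *: Linf ub + Linf vb))%qT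
  : ultrapower V omega).
  exact: (ucls_linf omega (a *: Linf ub + Linf vb)).
by rewrite clsD -clsZ !ucls_bseq.
Qed.

Lemma representsB u v x y : represents u x -> represents v y ->
  represents (fun n => u n - v n) (x - y).
Proof.
move=> ux vy; have := represents_linear (-1) vy ux.
rewrite scaleN1r addrC; congr represents; apply/funext => n.
by rewrite scaleN1r addrC.
Qed.

Lemma represents0 : represents (fun=> 0 : V) (0 : ultrapower V omega).
Proof.
have := representsB (represents_repr (0 : ultrapower V omega)) (represents_repr
  0).
by rewrite subrr; congr represents; apply/funext => n; rewrite subrr.
Qed.

Lemma representsZ (a : R[i]) u x : represents u x ->
  represents (fun n => a *: u n) (a *: x).
Proof.
move=> ux; have := represents_linear a ux represents0.
by rewrite addr0; congr represents; apply/funext => n; rewrite addr0.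
Qed.

Lemma represents_ucls u : bounded_seq u -> represents u (ucls omega u).
Proof. by []. Qed.

Let rnorm_lim u x : represents u x -> rnorm (u n) @[n --> om] --> rnorm x.
Proof.
move=> [/bseqP ub <-]; rewrite ucls_bseq.
have -> : rnorm ((\pi_(Quotient.quot (Tomega omega)) (Linf ub))%qT : ultrapower
  V omega) =
  ultra_rnorm ((\pi_(Quotient.quot (Tomega omega)) (Linf ub))%qT : ultrapower V
    omega) by [].
by rewrite ultra_rnormE; exact: (@is_cvg_rnorm R V omega (Linf ub)).
Qed.

Lemma represents_rnorm_lt u x (e : R) : represents u x -> rnorm x < e ->
  \forall n \near om, rnorm (u n) < e.
Proof. by move=> ux; exact: cvgr_lt (rnorm_lim ux) _. Qed.

Lemma represents_rnorm_le u x (e : R) : represents u x ->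
  (\forall n \near om, rnorm (u n) <= e) -> rnorm x <= e.
Proof.
move=> ux ue; rewrite -(cvg_lim _ (rnorm_lim ux))//.
by apply: limr_le => //; apply/cvg_ex; exists (rnorm x); exact: rnorm_lim.
Qed.

Lemma represents_near u w x : represents u x -> bounded_seq w ->
  (forall e : R, 0 < e -> \forall n \near om, rnorm (u n - w n) < e) ->
  represents w x.
Proof.
move=> [ub <-] wb uw; split=> //; apply/esym/ucls_eqP => //.
apply/cvgrPdist_lt => e /uw; apply: filterS => n.
by rewrite sub0r normrN ger0_norm// rnorm_ge0.
Qed.

Lemma represents_eq_near u w x : represents u x -> represents w x ->
  forall e : R, 0 < e -> \forall n \near om, rnorm (u n - w n) < e.
Proof.
move=> ux wx e e0; apply: (represents_rnorm_lt (representsB ux wx)).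
by rewrite subrr rnorm0.
Qed.

(** Boundedness makes [T (u n)] asymptotic to [T] of the representative chosen by [ultra_op]. *)
Lemma represents_op (T : V -> V) u x : bounded_linear T -> represents u x ->
  represents (fun n => T (u n)) (ultra_op (fun=> T) x).
Proof.
move=> [lT [M TM]] ux.
have M1 : 0 < `|M| + 1 by rewrite ltr_wpDl.
have TM' (z : V) : rnorm (T z) <= (`|M| + 1) * rnorm z.
  apply: (le_trans (TM z)); rewrite ler_wpM2r ?rnorm_ge0//.
  by rewrite (le_trans (ler_norm M))// lerDl.
have bT v : bounded_seq v -> bounded_seq (fun n => T (v n)).
  move=> [K vK]; exists ((`|M| + 1) * K) => n; apply: (le_trans (TM' _)).
  by rewrite ler_wpM2l// ltW.
apply: (@represents_near (fun n => T ((repr x : linf V) n))).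
- split=> //; apply: bT; exact: linf_bounded.
- by apply: bT; case: ux.
move=> e e0; have := represents_eq_near (represents_repr x) ux (divr_gt0 e0 M1).
apply: filterS => n; rewrite ltr_pdivlMr// mulrC => h.
by rewrite -(linear_mapB lT); exact: le_lt_trans (TM' _) h.
Qed.

(** Freeness yields a member of [omega] that misses a given number; finitely many of these are
    intersected. *)
Lemma free_near_ge k : \forall n \near om, (k <= n)%N.
Proof.
elim: k => [|k IH]; first exact: filterE.
have [W [Wom Wk]] : exists W, om W /\ ~ W k.
  apply: contrapT => h; have : (\bigcap_(W in om) W) k.
    by move=> W Wom; apply: contrapT => Wk; apply: h; exists W.
  by rewrite fu_free.
apply: filterS (filterI IH Wom) => n [kn Wn]; rewrite ltn_neqAle.
by apply/andP; split=> //; apply/eqP => kn'; apply: Wk; rewrite kn'; exact: Wn.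
Qed.

(** Let [a n] be the largest [k <= n] with [n] in [W k]; it is at least [k] on the part of [W k]
    beyond [k]. *)
Lemma saturation (W : nat -> set nat) : (forall k, om (W k)) ->
  exists a : nat -> nat, (forall k, \forall n \near om, (k <= a n)%N) /\
    \forall n \near om, W (a n) n.
Proof.
move=> Wom; pose p n (k : 'I_n.+1) := `[< W k n >].
exists (fun n => \max_(k < n.+1 | p n k) k); split=> [k|].
  apply: filterS (filterI (free_near_ge k) (Wom k)) => n [kn Wk].
  apply: (@leq_bigmax_cond _ _ (fun i : 'I_n.+1 =>
    i : nat) (Ordinal (kn : (k < n.+1)%N))).
  exact/asboolP.
apply: filterS (Wom 0%N) => n W0.
(* An empty maximum would be 0 without certifying [W 0 n]; on [W 0] the maximum is attained. *)
have : (0 < #|[pred k | p n k]|)%N.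
  by apply/card_gt0P; exists ord0; have : p n ord0 by exact/asboolP.
move=> /(eq_bigmax_cond (fun i : 'I_n.+1 => i : nat))[k pk ->].
by have /asboolP : p n k := pk.
Qed.

End ultrapower_representatives.

Lemma closure_rnormP {R : realType} {V : normedModType R[i]} (S : set V) (x :
  V) :
  closure S x <-> forall e : R, 0 < e -> exists2 y, S y & rnorm (x - y) < e.
Proof.
split=> [cx e e0|h B].
  have [|y [Sy]] := cx (ball x e%:C%C); first by apply: nbhsx_ballx;
    rewrite ltcR.
  by rewrite -ball_normE /ball_/= rnormE ltcR; exists y.
move=> /nbhs_ballP[e /= e0 eB].
have er : (complex.Re e)%:C%C = e by apply/RRe_real/gtr0_real.
have [|y Sy xy] := h (complex.Re e); first by rewrite -ltcR er.
exists y; split=> //; apply: eB.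
by rewrite -ball_normE /ball_/= rnormE -er ltcR.
Qed.

Lemma closure_prod_rnormP {R : realType} {V : normedModType R[i]}
    (S : set (V * V)) (x y : V) :
  closure S (x, y) <-> forall e : R, 0 < e ->
    exists x' y', [/\ S (x', y'), rnorm (x - x') < e & rnorm (y - y') < e].
Proof.
split=> [cx e e0|h B].
  have [|[x' y'] [Sy]] := cx (ball (x, y) e%:C%C).
    by apply: nbhsx_ballx; rewrite ltcR.
  rewrite /ball/= /prod_ball/= -!ball_normE /ball_/= !rnormE !ltcR => -[h1 h2].
  by exists x', y'.
move=> /nbhs_ballP[e /= e0 eB].
have er : (complex.Re e)%:C%C = e by apply/RRe_real/gtr0_real.
have [|x' [y' [Sxy xx yy]]] := h (complex.Re e); first by rewrite -ltcR er.
exists (x', y'); split=> //; apply: eB.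
by rewrite /ball/= /prod_ball/= -!ball_normE /ball_/= !rnormE -er !ltcR.
Qed.

(** * Tight sequences *)

Section tight_sequences.
Context {R : realType} {H : completeNormedModType R[i]}.
Context (dot : {dot H for Num.conj}).
Context (dot_norm : forall x : H, `|x| ^+ 2 = dot x x).
Context (omega : free_ultrafilter) (A : partial_op H).
Context (saA : self_adjoint dot A).
Context (E : set (measurableTypeR R) -> H -> H).
Context (specE : spectral_measure_of dot A E).
Implicit Types (x y z : ultrapower H omega) (u v w : nat -> H) (a b s t : R).

Let pvmE : projection_valued_measure dot E.
Proof. by case: specE. Qed.

Local Notation om := (fu_sets omega).
Local Notation U := (expi dot E).
Local Notation P a := (E `[- a, a]%classic).

Let mP a : measurable (`[- a, a]%classic : set (measurableTypeR R)).
Proof. exact: measurable_itv. Qed.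

Let lP a : linear (P a).
Proof. exact: (pvm_linear pvmE). Qed.

Let P_le a (f : H) : rnorm (P a f) <= rnorm f.
Proof. exact: (rnorm_pvm_le dot_norm pvmE). Qed.

Let subP_le a (f : H) : rnorm (f - P a f) <= rnorm f.
Proof. exact: (rnorm_subP_le dot_norm specE). Qed.

(** Here [1 - P b] factors as [(1 - P b)(1 - P a)], and [1 - P b] is a contraction. *)
Lemma rnorm_subP_mono a b (f : H) : a <= b -> rnorm (f - P b f) <= rnorm (f - P
  a f).
Proof.
move=> ab; have -> : f - P b f = (f - P a f) - P b (f - P a f).
  rewrite (linear_mapB (@lP b)) (pvm_segment_le pvmE _ ab) opprB addrA.
  by rewrite [_ - _ + _]addrNK.
exact: subP_le.
Qed.

Let bounded_P a u : bounded_seq u -> bounded_seq (fun n => P a (u n)).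
Proof. by move=> [M uM]; exists M => n; exact: le_trans (P_le _ _) (uM n). Qed.

Let bounded_AP a u : 0 <= a -> bounded_seq u -> bounded_seq (fun n =>
  A (P a (u n))).
Proof.
move=> a0 [M uM]; exists (a * M) => n.
by apply: le_trans (rnorm_app_segment_le dot_norm saA specE _ a0) _;
  rewrite ler_wpM2l.
Qed.

(* The spectral mass of a tight sequence asymptotically stays in a bounded set. *)
Definition tight u := forall e : R, 0 < e ->
  exists k : nat, \forall n \near om, rnorm (u n - P k%:R (u n)) < e.

(** Tightness is a closed condition because all [1 - P k] are contractions; in particular it depends
    only on the class. *)
Lemma tight_approx u :
  (forall e : R, 0 < e -> exists2 v, tight v &
    \forall n \near om, rnorm (u n - v n) < e) -> tight u.
Proof.
move=> uv e e0; have e2 : 0 < e / 2 by rewrite divr_gt0.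
have [v tv uve] := uv _ e2; have [k vk] := tv _ e2; exists k.
apply: filterS (filterI uve vk) => n [h1 h2].
have -> : u n - P k%:R (u n) =
    ((u n - v n) - P k%:R (u n - v n)) + (v n - P k%:R (v n)).
  by rewrite (linear_mapB (@lP k%:R)) addrACA subrK -opprD subrK.
apply: le_lt_trans (rnormD _ _) _.
by have := subP_le k%:R (u n - v n); lra.
Qed.

Lemma tight_represents u w x : represents u x -> represents w x -> tight u ->
  tight w.
Proof.
move=> ux wx tu; apply: tight_approx => e e0.
by exists u => //; exact: represents_eq_near wx ux _ e0.
Qed.

Lemma tight_linear (c : R[i]) u v : tight u -> tight v ->
  tight (fun n => c *: u n + v n).
Proof.
move=> tu tv e e0; have e2 : 0 < e / 2 by rewrite divr_gt0.
pose c1 := complex.Re `|c| + 1.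
have c0 : 0 <= complex.Re `|c| by rewrite -lecR RRe_real ?normr_ge0// ger0_real.
have c10 : 0 < c1 by rewrite ltr_wpDl.
have [k uk] := tu _ (divr_gt0 e2 c10); have [m vm] := tv _ e2.
exists (maxn k m); apply: filterS (filterI uk vm) => n [h1 h2].
have km : k%:R <= (maxn k m)%:R :> R by rewrite ler_nat leq_maxl.
have mm : m%:R <= (maxn k m)%:R :> R by rewrite ler_nat leq_maxr.
have {}h1 := le_lt_trans (rnorm_subP_mono _ km) h1.
have {}h2 := le_lt_trans (rnorm_subP_mono _ mm) h2.
rewrite lP opprD addrACA -scalerBr; apply: le_lt_trans (rnormD _ _) _.
rewrite rnormZ; have -> : e = e / 2 + e / 2 by lra.
apply: ler_ltD => //; move: h1; rewrite ltr_pdivlMr// => /ltW.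
apply: le_trans; rewrite mulrC ler_wpM2l ?rnorm_ge0// lerDl//.
Qed.

Lemma tightZ (c : R[i]) u : tight u -> tight (fun n => c *: u n).
Proof.
move=> tu; have t0 : tight (fun=> 0).
  move=> e e0; exists 0%N; apply: filterE => n.
  by rewrite (linear_map0 (@lP 0%:R)) subrr rnorm0.
have := tight_linear c tu t0; congr tight.
by apply/funext => n; rewrite addr0.
Qed.

Lemma tightB u v : tight u -> tight v -> tight (fun n => u n - v n).
Proof.
move=> tu tv; have := tight_linear (-1) tv tu; congr tight.
by apply/funext => n; rewrite scaleN1r addrC.
Qed.

Lemma tight_expi t u : tight u -> tight (fun n => U t (u n)).
Proof.
move=> tu e e0; have [k uk] := tu _ e0; exists k; apply: filterS uk => n.
rewrite -(expi_pvmC dot_norm pvmE)// -(linear_mapB (expi_linear dot_norm pvmE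
  t)).
by rewrite (rnorm_expi dot_norm pvmE).
Qed.

Lemma tight_segment a u : (forall n, P a (u n) = u n) -> tight u.
Proof.
move=> Pu e e0; exists (Num.trunc a).+1; apply: filterE => n.
by rewrite -(Pu n) (pvm_segment_le pvmE) ?subrr ?rnorm0// ltW// truncnS_gt.
Qed.

Lemma tight_dom u : (forall n, dom A (u n)) -> bounded_seq (fun n =>
  A (u n)) -> tight u.
Proof.
move=> du [M AuM] e e0; pose k := (Num.trunc (M / e)).+1; exists k.
apply: filterE => n; have k0 : 0 < k%:R :> R by rewrite ltr0n.
have Mk : M < e * k%:R by rewrite -ltr_pdivrMl// mulrC truncnS_gt.
have dP := dom_segment dot_norm specE k%:R (u n).
rewrite -(ltr_pM2l k0).
apply: le_lt_trans (_ : rnorm (A (u n - P k%:R (u n))) < _).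
  apply: (rnorm_app_off_segment dot_norm saA specE (ltW k0)).
    exact: (sa_domB saA).
  by rewrite (linear_mapB (@lP _)) (pvm_idem pvmE)// subrr.
rewrite (sa_B saA)// -(segment_appC dot_norm saA specE)//.
by apply: le_lt_trans (subP_le _ _) _; apply: le_lt_trans (AuM n) _;
  rewrite mulrC.
Qed.

(** Conversely, the truncations [P k (u n)] of a tight sequence give elements of [DA], since [A] is
    bounded by [k] on the range of [P k]. *)
Lemma HA_tight x u : represents u x -> HA omega A x <-> tight u.
Proof.
move=> ux; rewrite /HA closure_rnormP; split=> [Hx|tu e e0].
  apply: tight_approx => e e0; have [y [v [vy dv bv]] xy] := Hx _ e0.
  exists v; first exact: tight_dom.
  exact: represents_rnorm_lt (representsB ux vy) xy.
have e2 : 0 < e / 2 by rewrite divr_gt0.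
have [k uk] := tu _ e2; have bu := ux.1.
exists (ucls omega (fun n => P k%:R (u n))).
  exists (fun n => P k%:R (u n)); split.
  - exact/represents_ucls/bounded_P.
  - by move=> n; exact: (dom_segment dot_norm specE).
  - exact: bounded_AP.
apply: le_lt_trans (_ : e / 2 < _); last by lra.
apply: (represents_rnorm_le (representsB ux (represents_ucls (bounded_P k%:R
  bu)))).
by apply: filterS uk => n /ltW.
Qed.

Lemma KA_tight x u : represents u x -> KA dot omega E x <-> tight u.
Proof.
move=> ux; split=> [[w wx eqw]|tu].
  apply: (tight_represents wx ux) => e e0;
    have e4 : 0 < e / 4 by rewrite divr_gt0.
  (* At time 0 equicontinuity says that [U s] nearly fixes [w n], and [k > 16 / d] meets the
     condition of the truncation estimate. *)
  have [d d0 [W Wom eqd]] := eqw 0 _ e4.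
  pose k := (Num.trunc (16 / d)).+1; exists k; apply: filterS Wom => n Wn.
  have k0 : 0 < k%:R :> R by rewrite ltr0n.
  apply: le_lt_trans (_ : 2 * (e / 4) < _); last by lra.
  apply: (equicontinuous_truncation dot_norm saA specE d0 k0).
    by rewrite -ler_pdivrMl// mulrC ltW// truncnS_gt.
  move=> s sd; apply/ltW; have := eqd s n; rewrite subr0 => /(_ sd Wn).
  by rewrite (expi0 dot_norm pvmE) rnormB_C.
(* The tail [u n - P k (u n)] costs [e / 4] at each of the two times, [U] being isometric; on
   [P k (u n)] the group is Lipschitz with constant [2 k M]. *)
exists u => // t e e0; have e4 : 0 < e / 4 by rewrite divr_gt0.
have [k uk] := tu _ e4; have [M uM] := ux.1.
have M0 : 0 <= M := le_trans (rnorm_ge0 _) (uM 0%N).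
pose L := 2 * (k%:R * M) + 1.
have L0 : 0 < L by rewrite ltr_wpDl// !mulr_ge0.
exists (e / 4 / L); first exact: divr_gt0.
exists [set n | rnorm (u n - P k%:R (u n)) < e / 4]; first exact: uk.
move=> s n st /= uPn.
have lU r := expi_linear dot_norm pvmE r.
have -> : U t (u n) - U s (u n) = U t (u n - P k%:R (u n)) +
    (U t (P k%:R (u n)) - U s (P k%:R (u n))) - U s (u n - P k%:R (u n)).
  rewrite !(linear_mapB (@lU _)) addrA subrK opprB.
  by rewrite addrA subrK.
apply: le_lt_trans (rnormD _ _) _; rewrite rnormN (rnorm_expi dot_norm pvmE).
suff : rnorm (U t (u n - P k%:R (u n)) + (U t (P k%:R (u n)) - U s (P k%:R (u
  n)))) <=
    e / 4 + e / 4 by lra.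
apply: le_trans (rnormD _ _) _; rewrite (rnorm_expi dot_norm pvmE).
apply: lerD; first exact: ltW.
have -> : U s (P k%:R (u n)) = U t (U (s - t) (P k%:R (u n))).
  by rewrite -(expiD dot_norm pvmE) addrC subrK.
rewrite -(linear_mapB (@lU t)) (rnorm_expi dot_norm pvmE) rnormB_C.
have dP := dom_segment dot_norm specE k%:R (u n).
apply: le_trans (expi_lipschitz dot_norm saA specE (s - t) dP) _.
have AP : rnorm (A (P k%:R (u n))) <= k%:R * M.
  apply: le_trans (rnorm_app_segment_le dot_norm saA specE _ (ler0n _ _)) _.
  by rewrite ler_wpM2l.
have : `|s - t| * L <= e / 4 by rewrite -ler_pdivlMr// ltW.
have : `|s - t| * rnorm (A (P k%:R (u n))) <= `|s - t| * (k%:R * M) by rewrite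
  ler_wpM2l.
have := normr_ge0 (s - t).
by rewrite /L mulrDr mulr1; move: `|s - t| => r; lra.
Qed.

(* The reason why A_omega is well defined: P_k A u = A P_k u is a null sequence,
   and approximates A u when A u is tight. *)
Lemma app_null_tight u : (forall n, dom A (u n)) -> tight (fun n => A (u n)) ->
  (forall e : R, 0 < e -> \forall n \near om, rnorm (u n) < e) ->
  forall e : R, 0 < e -> \forall n \near om, rnorm (A (u n)) < e.
Proof.
move=> du tAu u0 e e0; have e2 : 0 < e / 2 by rewrite divr_gt0.
have [k Auk] := tAu _ e2.
have k1 : 0 < k%:R + 1 :> R by rewrite ltr_wpDl.
apply: filterS (filterI Auk (u0 _ (divr_gt0 e2 k1))) => n [h1].
rewrite ltr_pdivlMr// => h2.
rewrite -(subrK (P k%:R (A (u n))) (A (u n))).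
apply: le_lt_trans (rnormD _ _) _;
  rewrite (segment_appC dot_norm saA specE)// in h1 *.
have := rnorm_app_segment_le dot_norm saA specE (u n) (ler0n R k).
by have := rnorm_ge0 (u n); move: h1 h2; lra.
Qed.

(** The last condition says, on representatives, that the class of [A (u n)] lies in [HA]. *)
Definition regular_for u x := [/\ represents u x, forall n, dom A (u n),
  bounded_seq (fun n => A (u n)) & tight (fun n => A (u n))].

(** [u] provides a candidate for [xget]. A candidate coming from [v] has the same class, by
    [app_null_tight] for the null sequence [v - u]. *)
Lemma AomegaE x u : regular_for u x -> Aomega omega A x = ucls omega (fun n =>
  A (u n)).
Proof.
move=> [ux du bAu tAu] /=.
case: xgetP => [y _ [Hy [v [vx dv bAv Avy]]]|/(_ (ucls omega (fun n =>
  A (u n))))]; last first.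
  case; split; last by exists u.
  by apply/HA_tight; first exact: represents_ucls.
have vy : represents (fun n => A (v n)) y by [].
have tAv : tight (fun n => A (v n)) by apply/HA_tight; first exact: vy.
rewrite -Avy; apply/ucls_eqP => //.
apply/cvgrPdist_lt => e e0.
have dB n : A (v n - u n) = A (v n) - A (u n) by rewrite (sa_B saA).
have := @app_null_tight (fun n =>
  v n - u n) _ _ (represents_eq_near vx ux) e e0.
rewrite (_ : (fun n => A (v n - u n)) = fun n => A (v n) - A (u n));
  last exact/funext.
move=> /(_ (fun n => sa_domB saA (dv n) (du n)) (tightB tAv tAu)).
apply: filterS => n; rewrite dB.
by rewrite sub0r normrN ger0_norm// rnorm_ge0.
Qed.

(* The representative of x is P_{a_n} u_n, for levels a_n -> oo chosen so slowly
   that A P_{a_n} u_n stays asymptotic to P_{a_n} w_n. *)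
Lemma graph_limit x y u w : represents u x -> represents w y ->
  tight u -> tight w ->
  (forall k (e : R), 0 < e ->
    \forall n \near om, rnorm (A (P k%:R (u n)) - P k%:R (w n)) < e) ->
  DA omega A x /\ Aomega omega A x = y.
Proof.
move=> ux wy tu tw AP.
pose W (k : nat) := [set n | rnorm (A (P k%:R (u n)) - P k%:R (w n)) <
  k.+1%:R^-1].
have Wom k : om (W k) by apply: AP; rewrite invr_gt0 ltr0n.
have [a [a_ge aW]] := saturation Wom.
(* The value 0 off the good set keeps [A (v n)] bounded for every [n]; the class only sees almost
   all [n]. *)
pose v n := if `[< W (a n) n >] then P (a n)%:R (u n) else 0.
have [Mu uM] := ux.1; have [Mw wM] := wy.1.
have Mu0 : 0 <= Mu := le_trans (rnorm_ge0 _) (uM 0%N).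
have Mw0 : 0 <= Mw := le_trans (rnorm_ge0 _) (wM 0%N).
have dv n : dom A (v n).
  by rewrite /v; case: ifP => _; [exact: (dom_segment dot_norm specE)|exact:
    (sa_dom0 saA)].
have A0 : A 0 = 0 by have := sa_B saA (sa_dom0 saA) (sa_dom0 saA);
  rewrite !subrr.
have bAv : bounded_seq (fun n => A (v n)).
  exists (1 + Mw) => n; rewrite /v; case: ifP => [/asboolP Wn|_]; last first.
    by rewrite A0 rnorm0 addr_ge0.
  rewrite -(subrK (P (a n)%:R (w n)) (A _)); apply: le_trans (rnormD _ _) _.
  apply: lerD; last exact: le_trans (P_le _ _) (wM n).
  by apply: le_trans (ltW Wn) _; rewrite invf_le1 ?ltr0n// ler1n.
have bv : bounded_seq v.
  exists Mu => n; rewrite /v; case: ifP => _; last by rewrite rnorm0.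
  exact: le_trans (P_le _ _) (uM n).
have vx : represents v x.
  apply: (represents_near ux bv) => e e0; have [k uk] := tu _ e0.
  apply: filterS (filterI uk (filterI (a_ge k) aW)) => n [h1 [h2 h3]].
  rewrite /v asboolT//; apply: le_lt_trans h1; apply: rnorm_subP_mono.
  by rewrite ler_nat.
have Avy : represents (fun n => A (v n)) y.
  apply: (represents_near wy bAv) => e e0;
    have e2 : 0 < e / 2 by rewrite divr_gt0.
  have [k wk] := tw _ e2.
  (* Since [m > 2 / e], the error [1 / (a n + 1)] is below [e / 2] once [m <= a n]. *)
  pose m := (Num.trunc (e / 2)^-1).+1.
  apply: filterS (filterI wk (filterI (a_ge (maxn k m)) aW)) => n [h1 [h2 h3]].
  rewrite /v asboolT//.
  have ka : (k%:R : R) <= (a n)%:R by rewrite ler_nat (leq_trans (leq_maxl _ _)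
    h2).
  have ma : (m <= a n)%N by rewrite (leq_trans (leq_maxr _ _) h2).
  rewrite -(subrK (P (a n)%:R (w n)) (w n)) -addrA;
    apply: le_lt_trans (rnormD _ _) _.
  have -> : e = e / 2 + e / 2 by lra.
  apply: ltrD; first exact: le_lt_trans (rnorm_subP_mono _ ka) h1.
  rewrite rnormB_C; apply: lt_le_trans h3 _.
  rewrite -[leRHS]invrK lef_pV2 ?posrE ?ltr0n ?invr_gt0//.
  apply: le_trans (ltW (truncnS_gt _)) _; rewrite ler_nat.
  by rewrite (leq_trans ma).
have rv : regular_for v x.
  by split=> //; exact: tight_represents wy Avy tw.
split; first by exists v.
by rewrite (AomegaE rv); exact: Avy.2.
Qed.

End tight_sequences.

(** * Comparison of the two operators *)

Section generator.
Context {R : realType} {H : completeNormedModType R[i]}.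
Context (dot : {dot H for Num.conj}).
Context (dot_norm : forall x : H, `|x| ^+ 2 = dot x x).
Context (omega : free_ultrafilter) (A : partial_op H).
Context (saA : self_adjoint dot A).
Context (E : set (measurableTypeR R) -> H -> H).
Context (specE : spectral_measure_of dot A E).
Implicit Types (x y z : ultrapower H omega) (u v w : nat -> H) (a b s t : R).

Let pvmE : projection_valued_measure dot E.
Proof. by case: specE. Qed.

Local Notation om := (fu_sets omega).
Local Notation U := (expi dot E).
Local Notation P a := (E `[- a, a]%classic).
Local Notation tight := (tight omega E).
Local Notation regular_for := (@regular_for R H omega A E).

Let mP a : measurable (`[- a, a]%classic : set (measurableTypeR R)).
Proof. exact: measurable_itv. Qed.

Let lP a : linear (P a).
Proof. exact: (pvm_linear pvmE). Qed.

Let P_le a (f : H) : rnorm (P a f) <= rnorm f.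
Proof. exact: (rnorm_pvm_le dot_norm pvmE). Qed.

Let P_increment a b (f : H) : a <= b ->
  rnorm (P b f - P a f) ^+ 2 = rnorm (P b f) ^+ 2 - rnorm (P a f) ^+ 2.
Proof.
by move=> ab; rewrite -{1 2}(pvm_segment_ge pvmE f ab) (rnorm_pvmC dot_norm
  pvmE).
Qed.

(* Truncating at levels a_n -> oo chosen so slowly that |P_{a_n} A u_n| tends to
   sup_k lim_n |P_k A u_n| turns A u into a tight sequence. *)
Lemma ex_regular x : DA omega A x -> exists u, regular_for u x.
Proof.
move=> [u [ux du [M AuM]]].
have M0 : 0 <= M := le_trans (rnorm_ge0 _) (AuM 0%N).
pose q k n := rnorm (P k%:R (A (u n))) ^+ 2.
have qM k n : q k n <= M ^+ 2.
  by rewrite ler_pXn2r ?nnegrE ?rnorm_ge0//; exact: le_trans (P_le _ _) (AuM n).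
have q_cvg k : cvg (q k n @[n --> om]).
  by apply: (bounded_ultralimit (M := M ^+ 2)) => n; rewrite ger0_norm ?sqr_ge0.
pose phi k := lim (q k n @[n --> om]).
have q_mono k m n : (k <= m)%N -> q k n <= q m n.
  move=> km; rewrite -subr_ge0 -P_increment ?sqr_ge0//.
  by rewrite ler_nat.
have phi_mono : nondecreasing_seq phi.
  by move=> k m km; apply: ler_lim => //; apply: filterE => n; exact: q_mono.
have phi_M k : phi k <= M ^+ 2 by apply: limr_le => //; exact: filterE.
have phi_cvg : cvgn phi.
  by apply: nondecreasing_is_cvgn => //; exists (M ^+ 2) => _ [k _ <-].
set L := lim (phi n @[n --> \oo]) in phi_cvg.
have phi_L k : phi k <= L by apply: nondecreasing_cvgn_le.
pose W (k : nat) := [set n | `|phi k - q k n| < k.+1%:R^-1].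
have Wom k : om (W k).
  have /cvgrPdist_lt h := q_cvg k; apply: h.
  by rewrite invr_gt0 ltr0n.
have [a [a_ge aW]] := saturation Wom.
exists (fun n => P (a n)%:R (u n)); split.
- apply: (represents_near ux).
    by have [K uK] := ux.1; exists K => n; exact: le_trans (P_le _ _) (uK n).
  (* Truncation at [a n] keeps the class: [u] is tight and [a n] tends to infinity. *)
  have tu : tight u by apply: (tight_dom dot_norm omega saA specE du); exists M.
  move=> e e0; have [k uk] := tu _ e0.
  apply: filterS (filterI uk (a_ge k)) => n [h1 h2]; apply: le_lt_trans h1.
  apply: ler_of_sqr; first exact: rnorm_ge0.
  rewrite !(rnorm_pvmC dot_norm pvmE)// lerD2l lerN2.
  have kan : (k%:R : R) <= (a n)%:R by rewrite ler_nat.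
  by rewrite -subr_ge0 -P_increment// sqr_ge0.
- by move=> n; exact: (dom_segment dot_norm specE).
- exists M => n; rewrite -(segment_appC dot_norm saA specE)//.
  exact: le_trans (P_le _ _) (AuM n).
(* The squared tail is [q (a n) n - q K n], less than [L - phi K] plus [1 / (a n + 1)] plus
   [1 / (K + 1)]; [K] makes each of the three less than [e^2 / 3]. *)
move=> e e0; have e3 : 0 < e ^+ 2 / 3 by rewrite divr_gt0// exprn_gt0.
have /cvgrPdist_lt/(_ _ e3) h1 := phi_cvg.
have /cvgrPdist_lt/(_ _ e3) h2 := @cvg_harmonic R.
have [K [/= phiK]] := filter_ex (filterI h1 h2).
rewrite sub0r normrN ger0_norm ?invr_ge0 ?ler0n// => harmK.
exists K; apply: filterS (filterI (Wom K) (filterI aW (a_ge K))) =>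
  n [WK [Wa Ka]].
have kan : (K%:R : R) <= (a n)%:R by rewrite ler_nat.
rewrite -(segment_appC dot_norm saA specE)// (pvm_segment_ge pvmE)//.
rewrite -(ltr_pXn2r (n := 2)) ?nnegrE ?rnorm_ge0 ?(ltW e0)// P_increment//.
rewrite -/(q K n) -/(q (a n) n).
have harm : (a n).+1%:R^-1 <= K.+1%:R^-1 :> R by rewrite lef_pV2 ?posrE
  ?ltr0n// ler_nat.
have := phi_L (a n).
move: WK Wa phiK; rewrite /W/= !ltr_norml =>
  /andP[_ w1] /andP[w2 _] /andP[_ w3] w4.
move: (K.+1%:R^-1) ((a n).+1%:R^-1) harm harmK w1 w2 => r1 r2 *; lra.
Qed.

Let dq t (f : H) : H := (t%:C%C)^-1 *: (U t f - f).

Let dq_linear t : linear (dq t).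
Proof.
move=> c f g; have lU := expi_linear dot_norm pvmE t.
by rewrite /dq lU opprD addrACA -scalerBr scalerDr !scalerA mulrC.
Qed.

Let norm_realV t : complex.Re `|(t%:C%C)^-1 : R[i]| = `|t|^-1.
Proof.
have -> : `|(t%:C%C)^-1 : R[i]| = (`|t|^-1)%:C%C.
  by rewrite normfV normc_def /= expr0n addr0 sqrtr_sqr;
    exact: (esym (fmorphV (real_complex R) _)).
by [].
Qed.

Let norm_i : complex.Re `|'i%C : R[i]| = 1.
Proof. by rewrite normc_def/= expr0n expr1n add0r sqrtr1. Qed.

Let dq_segment t a (f : H) : t != 0 -> 0 <= a ->
  rnorm (dq t (P a f) - 'i%C *: A (P a f)) <= 2 * `|t| * a ^+ 2 * rnorm f.
Proof.
move=> t0 a0; have tC : (t%:C%C : R[i]) != 0.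
  by apply: contra_neq t0 => -[].
have -> : dq t (P a f) - 'i%C *: A (P a f) =
   (t%:C%C)^-1 *: (U t (P a f) - P a f - ('i * t%:C)%C *: A (P a f)).
  by rewrite scalerBr scalerA mulrCA mulVf// mulr1.
rewrite rnormZ norm_realV ler_pdivrMl ?normr_gt0//.
apply: le_trans (expi_taylor dot_norm saA specE t f a0) _.
by rewrite exprMn -sqr_normr !mulrA; move: (rnorm f) => r; rewrite le_eqVlt;
  apply/orP; left; apply/eqP; ring.
Qed.

(** The Taylor estimate handles [P a f]. On the rest [g] the quotient is at most [2 |A g|] by the
    Lipschitz bound, and subtracting [i A g] makes it 3. *)
Let dq_bound t a (f : H) : t != 0 -> 0 <= a -> dom A f ->
  rnorm (dq t f - 'i%C *: A f) <=
  2 * `|t| * a ^+ 2 * rnorm f + 3 * rnorm (A f - P a (A f)).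
Proof.
move=> t0 a0 df; have dP := dom_segment dot_norm specE a f.
pose g := f - P a f; have dg : dom A g by exact: (sa_domB saA).
have Ag : A g = A f - P a (A f).
  by rewrite /g (sa_B saA)// (segment_appC dot_norm saA specE).
have -> : dq t f - 'i%C *: A f =
    (dq t (P a f) - 'i%C *: A (P a f)) + (dq t g - 'i%C *: A g).
  have Pg : P a f + g = f by rewrite /g addrC subrK.
  have APg : A (P a f) + A g = A f.
    by rewrite Ag (segment_appC dot_norm saA specE)// addrC subrK.
  by rewrite addrACA -(linear_mapD (@dq_linear t)) -opprD -scalerDr Pg APg.
apply: le_trans (rnormD _ _) _; apply: lerD; first exact: dq_segment.
apply: le_trans (rnormD _ _) _;
  rewrite rnormN !rnormZ norm_realV norm_i mul1r -Ag.
have t1 : 0 < `|t| by rewrite normr_gt0.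
have : `|t|^-1 * rnorm (U t g - g) <= 2 * rnorm (A g).
  rewrite ler_pdivrMl// mulrCA mulrA.
  exact: (expi_lipschitz dot_norm saA specE).
by move: (rnorm (A g)) => r; lra.
Qed.

Let represents_dq t u x : represents u x ->
  represents (fun n => dq t (u n)) (diff_quot dot E x t).
Proof.
move=> ux; apply: representsZ; apply: representsB => //;
  apply: represents_op => //.
split; first exact: (expi_linear dot_norm pvmE).
by exists 1 => f; rewrite (rnorm_expi dot_norm pvmE) mul1r.
Qed.

(** Tightness of [A u] fixes a level [k] with error at most [3 e / 6] for almost all [n]; only then
    is [t] taken small, for an error [e / 4] uniform in [n]. *)
Lemma diff_quot_cvg x u : regular_for u x ->
  diff_quot dot E x t @[t --> 0^'] --> 'i%C *: ucls omega (fun n => A (u n)).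
Proof.
move=> [ux du bAu tAu]; apply/rnorm_cvgP => e e0.
have e6 : 0 < e / 6 by rewrite divr_gt0.
have [k Auk] := tAu _ e6; have [M uM] := ux.1.
have M0 : 0 <= M := le_trans (rnorm_ge0 _) (uM 0%N).
pose L : R := 2 * k%:R ^+ 2 * M + 1.
have L0 : 0 < L by rewrite ltr_wpDl// !mulr_ge0// sqr_ge0.
have d0 : 0 < e / 4 / L by rewrite !divr_gt0.
apply/nbhs_ballP; exists (e / 4 / L) => //= t;
  rewrite /ball/= sub0r normrN => td /= t0.
have iAu : represents (fun n => 'i%C *: A (u n)) ('i%C *: ucls omega (fun n =>
  A (u n))).
  exact/representsZ/represents_ucls.
apply: le_lt_trans (_ : e * (3 / 4) < _); last by lra.
apply: (represents_rnorm_le (representsB iAu (represents_dq t ux))).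
apply: filterS Auk => n h; rewrite rnormB_C.
apply: le_trans (dq_bound t0 (ler0n R k) (du n)) _.
have h1 : 2 * `|t| * k%:R ^+ 2 * rnorm (u n) <= `|t| * (2 * k%:R ^+ 2 * M).
  have -> : 2 * `|t| * k%:R ^+ 2 * rnorm (u n) = `|t| * (2 * k%:R ^+ 2 * rnorm
    (u n)) by ring.
  by rewrite ler_wpM2l// ler_wpM2l// mulr_ge0// sqr_ge0.
have h2 : `|t| * L <= e / 4 by rewrite -ler_pdivlMr// ltW.
have h3 : `|t| * (2 * k%:R ^+ 2 * M) <= e / 4.
  by apply: le_trans h2; rewrite ler_wpM2l// lerDl.
by lra.
Qed.

(** Difference quotients of a tight sequence are tight, hence so is their limit [i w]. As [P k]
    commutes with them, [A (P k u)] is asymptotic to [P k w], and [graph_limit] applies. *)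
Lemma Atilde_dom x : KA dot omega E x -> cvg (diff_quot dot E x t @[t --> 0^'])
  ->
  DA omega A x.
Proof.
move=> Kx cv; set z := lim _ in cv.
pose y := ('i%C)^-1 *: z.
have zE : z = 'i%C *: y.
  by rewrite /y scalerA divff ?scale1r// eq_complex/= oner_eq0 andbF.
have ux := represents_repr x; set u : nat -> H := repr x : linf H in ux.
have wy := represents_repr y; set w : nat -> H := repr y : linf H in wy.
have tu : tight u by apply/(KA_tight dot_norm saA specE ux).
have approx (e d : R) : 0 < e -> 0 < d -> exists t, [/\ t != 0, `|t| < d &
    \forall n \near om, rnorm ('i%C *: w n - dq t (u n)) < e].
  move=> e0 d0; have /rnorm_cvgP/(_ _ e0) h1 := cv.
  have h2 : \forall t \near (0 : R)^', `|t| < d.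
    by apply/nbhs_ballP; exists d => //= t; rewrite /ball/= sub0r normrN.
  have h3 : \forall t \near (0 : R)^', t != 0 by exact: nbhs_dnbhs_neq.
  have [t [zt [td t0]]] := @filter_ex _ (0 : R)^' _ _ (filterI h1 (filterI h2
    h3)).
  rewrite zE in zt; exists t; split=> //.
  exact: (represents_rnorm_lt (representsB (representsZ 'i%C wy) (represents_dq
    t ux)) zt).
have tw : tight w.
  have : tight (fun n => 'i%C *: w n).
    apply: (tight_approx dot_norm specE) => e e0.
    have [t [t0 _ wt]] := approx e 1 e0 ltr01.
    exists (fun n => dq t (u n)) => //.
    apply: (tightZ dot_norm specE); apply: (tightB dot_norm specE) => //.
    exact: (tight_expi dot_norm specE).
  move=> /(tightZ dot_norm specE ('i%C)^-1); congr (tight); apply/funext => n.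
  by rewrite scalerA mulVf ?scale1r// eq_complex/= oner_eq0 andbF.
have [M uM] := ux.1; have M0 : 0 <= M := le_trans (rnorm_ge0 _) (uM 0%N).
apply: (proj1 (graph_limit dot_norm saA specE ux wy tu tw _)) => k e e0.
pose L : R := 2 * k%:R ^+ 2 * M + 1.
have L0 : 0 < L by rewrite ltr_wpDl// !mulr_ge0// sqr_ge0.
have e2 : 0 < e / 2 by rewrite divr_gt0.
(* A single [t] is enough: its quotient is [e / 2]-close to [i w], and its Taylor error at level [k]
   is at most [e / 2]. *)
have [t [t0 td wt]] := approx _ _ e2 (divr_gt0 e2 L0).
apply: filterS wt => n h.
have -> : rnorm (A (P k%:R (u n)) - P k%:R (w n)) =
    rnorm (P k%:R ('i%C *: w n - dq t (u n)) +
           (dq t (P k%:R (u n)) - 'i%C *: A (P k%:R (u n)))).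
  have -> : dq t (P k%:R (u n)) = P k%:R (dq t (u n)).
    rewrite /dq (expi_pvmC dot_norm pvmE)//.
    by rewrite (linear_mapZ (@lP _)) (linear_mapB (@lP _)).
  rewrite (linear_mapB (@lP _)) addrA subrK (linear_mapZ (@lP _)) -scalerBr.
  by rewrite rnormZ norm_i mul1r rnormB_C.
apply: le_lt_trans (rnormD _ _) _; have -> : e = e / 2 + e / 2 by lra.
apply: ltr_leD; first exact: le_lt_trans (P_le _ _) h.
apply: le_trans (dq_segment _ t0 (ler0n R k)) _.
have h2 : `|t| * L <= e / 2 by rewrite -ler_pdivlMr// ltW.
apply: le_trans h2.
have -> : 2 * `|t| * k%:R ^+ 2 * rnorm (u n) = `|t| * (2 * k%:R ^+ 2 * rnorm (u
  n)) by ring.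
rewrite ler_wpM2l// /L; apply: ler_wpDr => //.
by rewrite ler_wpM2l// mulr_ge0// sqr_ge0.
Qed.

End generator.

(** * The core of A_omega and proper sequences *)

Section core.
Context {R : realType} {H : completeNormedModType R[i]}.
Context (dot : {dot H for Num.conj}).
Context (dot_norm : forall x : H, `|x| ^+ 2 = dot x x).
Context (omega : free_ultrafilter) (A : partial_op H).
Context (saA : self_adjoint dot A).
Context (E : set (measurableTypeR R) -> H -> H).
Context (specE : spectral_measure_of dot A E).
Implicit Types (x y z : ultrapower H omega) (u v w : nat -> H) (a b s t : R).

Let pvmE : projection_valued_measure dot E.
Proof. by case: specE. Qed.

Local Notation om := (fu_sets omega).
Local Notation P a := (E `[- a, a]%classic).

Let mP a : measurable (`[- a, a]%classic : set (measurableTypeR R)).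
Proof. exact: measurable_itv. Qed.

Let lP a : linear (P a).
Proof. exact: (pvm_linear pvmE). Qed.

Let P_le a (f : H) : rnorm (P a f) <= rnorm f.
Proof. exact: (rnorm_pvm_le dot_norm pvmE). Qed.

Lemma spectral_subspaceP a (f : H) : spectral_subspace E a f <-> P a f = f.
Proof.
split=> [[g _ <-]|<-]; first exact: (pvm_idem pvmE).
by exists f.
Qed.

Let regular_segment a u : bounded_seq u -> 0 <= a -> (forall n, P a (u n) = u
  n) ->
  regular_for A E u (ucls omega u).
Proof.
move=> ub a0 Pu; have du n : dom A (u n).
  by rewrite -Pu; exact: (dom_segment dot_norm specE).
split=> //.
  have [M uM] := ub; exists (a * M) => n; rewrite -Pu.
  apply: le_trans (rnorm_app_segment_le dot_norm saA specE _ a0) _.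
  by rewrite ler_wpM2l.
apply: (tight_segment omega specE (a := a)) => n.
by rewrite (segment_appC dot_norm saA specE)// Pu.
Qed.

Lemma D0_subspace : is_subspace (D0 omega E).
Proof.
split.
  exists 1 => //; exists (fun=> 0); first exact: represents0.
  by move=> n; apply/spectral_subspaceP; rewrite (linear_map0 (@lP 1)).
move=> c x y [a a0 [u ux Pu]] [b b0 [v vy Pv]].
exists (Num.max a b); first by rewrite lt_max a0.
exists (fun n => c *: u n + v n); first exact: represents_linear.
move=> n; apply/spectral_subspaceP; rewrite lP.
have /spectral_subspaceP <- := Pu n; have /spectral_subspaceP <- := Pv n.
by rewrite !(pvm_segment_le pvmE)// le_max lexx ?orbT.
Qed.

Lemma D0_sub_DA : D0 omega E `<=` DA omega A.
Proof.
move=> x [a a0 [u ux Pu]]; have [ub ux'] := ux.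
have [//|_ du bAu _] := @regular_segment a u ub (ltW a0).
  by move=> n; exact/spectral_subspaceP.
by exists u.
Qed.

(** One inclusion is closedness of [Aomega], obtained from [graph_limit] by comparison with
    approximants [v] at each fixed level. For the other, truncating a regular representative
    approximates both [u] and [A u]. *)
Lemma core_closure : closure (graph_on (D0 omega E) (Aomega omega A)) =
  graph_on (dom (Aomega omega A)) (Aomega omega A).
Proof.
apply/seteqP; split=> -[x y].
  move=> /closure_prod_rnormP cl.
  have ux := represents_repr x; set u : nat -> H := repr x : linf H in ux.
  have wy := represents_repr y; set w : nat -> H := repr y : linf H in wy.
  have approx e : 0 < e -> exists v, [/\ forall n, dom A (v n), tight omega E v,
      tight omega E (fun n => A (v n)),
      \forall n \near om, rnorm (u n - v n) < e &
      \forall n \near om, rnorm (w n - A (v n)) < e].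
    move=> e0; have [x' [y' [[/= D0x' ->] xx yy]]] := cl _ e0.
    have [v rv] := ex_regular dot_norm saA specE (D0_sub_DA D0x').
    have [vx' dv bAv tAv] := rv; exists v; split=> //.
    - exact: (tight_dom dot_norm omega saA specE dv bAv).
    - exact: (represents_rnorm_lt (representsB ux vx') xx).
    - have {}yy : rnorm (y - Aomega omega A x') < e := yy.
      rewrite (AomegaE dot_norm saA specE rv) in yy.
      exact: (represents_rnorm_lt (representsB wy (represents_ucls bAv)) yy).
  have tu : tight omega E u.
    by apply: (tight_approx dot_norm specE) => e /approx[v [_ tv _ uv _]];
      exists v.
  have tw : tight omega E w.
    apply: (tight_approx dot_norm specE) => e /approx[v [_ _ tAv _ wv]].
    by exists (fun n => A (v n)).
  have [|Dx Axy] := graph_limit dot_norm saA specE ux wy tu tw; last by split.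
  move=> k e e0; have k1 : 0 < k%:R + 1 :> R by rewrite ltr_wpDl.
  (* [A P_k] has norm at most [k] and [P_k] at most 1, whence the tolerance [e / (k + 1)]. *)
  have [v [dv _ _ uv wv]] := approx _ (divr_gt0 e0 k1).
  apply: filterS (filterI uv wv) => n [h1 h2].
  have -> : A (P k%:R (u n)) - P k%:R (w n) =
      A (P k%:R (u n - v n)) - P k%:R (w n - A (v n)).
    have dP f := dom_segment dot_norm specE k%:R f.
    rewrite !(linear_mapB (@lP _)) (sa_B saA)//.
    rewrite (segment_appC dot_norm saA specE k%:R (dv n)).
    by rewrite opprB addrA subrK.
  apply: le_lt_trans (rnormD _ _) _; rewrite rnormN.
  have h3 := rnorm_app_segment_le dot_norm saA specE (u n - v n) (ler0n R k).
  have h4 := P_le k%:R (w n - A (v n)).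
  have h5 : k%:R * rnorm (u n - v n) <= k%:R * (e / (k%:R + 1)).
    by rewrite ler_wpM2l// ltW.
  have h6 : k%:R * (e / (k%:R + 1)) + e / (k%:R + 1) = e.
    by rewrite -{2}[e / _]mul1r -mulrDl mulrC divfK// gt_eqF.
  move: (k%:R * (e / (k%:R + 1))) (e / (k%:R + 1)) h2 h5 h6 => r1 r2 *; lra.
move=> [Dx yE]; have {yE}-> : y = Aomega omega A x := yE.
have {}Dx : DA omega A x := Dx; apply/closure_prod_rnormP => e e0.
have [u ru] := ex_regular dot_norm saA specE Dx; have [ux du bAu tAu] := ru.
have tu := tight_dom dot_norm omega saA specE du bAu.
have e2 : 0 < e / 2 by rewrite divr_gt0.
have [k1 uk1] := tu _ e2; have [k2 Auk2] := tAu _ e2.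
(* One level for both [u] and [A u], positive as [D0] demands. *)
pose k : R := Num.max 1 (Num.max k1%:R k2%:R).
have k0 : 0 < k by rewrite lt_max ltr01.
have k1k : k1%:R <= k by rewrite !le_max lexx orbT.
have k2k : k2%:R <= k by rewrite !le_max lexx !orbT.
pose v n := P k (u n).
have bv : bounded_seq v by have [M uM] := ux.1; exists M => n;
  exact: le_trans (P_le _ _) (uM n).
have Pv n : P k (v n) = v n by rewrite /v (pvm_idem pvmE).
have rv := regular_segment bv (ltW k0) Pv; have [_ dv bAv _] := rv.
exists (ucls omega v), (Aomega omega A (ucls omega v)); split.
- split=> //=; exists k => //; exists v; first exact: represents_ucls.
  by move=> n; apply/spectral_subspaceP.
- apply: le_lt_trans (_ : e / 2 < _); last by lra.
  apply: (represents_rnorm_le (representsB ux (represents_ucls bv))).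
  apply: filterS uk1 => n /ltW; apply: le_trans.
  exact: (rnorm_subP_mono dot_norm specE).
rewrite (AomegaE dot_norm saA specE ru) (AomegaE dot_norm saA specE rv).
apply: le_lt_trans (_ : e / 2 < _); last by lra.
apply: (represents_rnorm_le (representsB (represents_ucls bAu) (represents_ucls
  bAv))).
apply: filterS Auk2 => n /ltW; apply: le_trans.
rewrite /v -(segment_appC dot_norm saA specE)//.
exact: (rnorm_subP_mono dot_norm specE).
Qed.

(** Both sides amount to boundedness and tightness of [A (u n)]: truncations of [u] witness
    properness, and conversely the graph norm dominates [|A (u n) - A (v n)|], where [A (v n)] is
    tight. *)
Lemma regular_iff_proper x u : DA omega A x -> represents u x -> (forall n, dom
  A (u n)) ->
  (bounded_seq (fun n => A (u n)) /\ ucls omega (fun n =>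
    A (u n)) = Aomega omega A x) <->
  proper_A_sequence omega A E u.
Proof.
move=> Dx ux du.
have gn_ge (f : H) : rnorm f <= graph_norm A f /\ rnorm (A f) <= graph_norm A f.
  by split; (apply: ler_of_sqr; first exact: sqrtr_ge0);
    rewrite sqr_sqrtr ?addr_ge0 ?sqr_ge0// ?lerDl ?lerDr sqr_ge0.
have gn_le (f : H) : graph_norm A f <= rnorm f + rnorm (A f).
  apply: ler_of_sqr; first by rewrite addr_ge0 ?rnorm_ge0.
  rewrite sqr_sqrtr ?addr_ge0 ?sqr_ge0// sqrrD.
  by rewrite -addrA [X in _ <= _ + X]addrC addrA lerDl mulrn_wge0// mulr_ge0
    ?rnorm_ge0.
(* A bound on [lim] is informative only if the limit exists; bounded sequences converge along an
   ultrafilter. *)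
have gn_cvg v : (forall n, dom A (v n)) -> bounded_seq u -> bounded_seq v ->
    bounded_seq (fun n => A (u n)) -> bounded_seq (fun n => A (v n)) ->
    cvg (graph_norm A (u n - v n) @[n --> om]).
  move=> dv [M1 h1] [M2 h2] [M3 h3] [M4 h4].
  apply: (bounded_ultralimit (M := (M1 + M2) + (M3 + M4))) => n.
  rewrite ger0_norm ?sqrtr_ge0//; apply: le_trans (gn_le _) _.
  rewrite (sa_B saA)//; apply: lerD; apply: le_trans (rnormD _ _) _;
    by rewrite rnormN lerD.
split=> [[bAu Aux]|[_ bAu proper]].
  have [v rv] := ex_regular dot_norm saA specE Dx.
  have tAu : tight omega E (fun n => A (u n)).
    have [_ _ bAv tAv] := rv.
    apply: (tight_represents dot_norm specE (represents_ucls bAv) _ tAv).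
    by split=> //; rewrite Aux (AomegaE dot_norm saA specE rv).
  have tu := tight_dom dot_norm omega saA specE du bAu.
  split=> // [|e e0]; first by split=> //; exact: ux.1.
  (* Two tails below [e / 4] give a limit at most [e / 2], which restores the strict inequality lost
     in the limit. *)
  have e4 : 0 < e / 4 by rewrite divr_gt0.
  have [k1 uk1] := tu _ e4; have [k2 Auk2] := tAu _ e4.
  pose k : R := Num.max 1 (Num.max k1%:R k2%:R).
  have k0 : 0 < k by rewrite lt_max ltr01.
  have k1k : k1%:R <= k by rewrite !le_max lexx orbT.
  have k2k : k2%:R <= k by rewrite !le_max lexx !orbT.
  pose w n := P k (u n).
  have bw : bounded_seq w.
    by have [M uM] := ux.1; exists M => n; exact: le_trans (P_le _ _) (uM n).
  have Pw n : P k (w n) = w n by rewrite /w (pvm_idem pvmE).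
  have [_ dw bAw _] := regular_segment bw (ltW k0) Pw.
  exists k => //; exists w; split=> // [n|]; first exact/spectral_subspaceP.
  apply: le_lt_trans (_ : e / 2 < _); last by lra.
  apply: limr_le; first by apply: gn_cvg => //; exact: ux.1.
  apply: filterS (filterI uk1 Auk2) => n [h1 h2].
  apply: le_trans (gn_le _) _; rewrite (sa_B saA)// /w -(segment_appC dot_norm
    saA specE)//.
  have h3 := rnorm_subP_mono dot_norm specE (u n) k1k.
  have h4 := rnorm_subP_mono dot_norm specE (A (u n)) k2k.
  by move: h1 h2; lra.
split=> //; apply/esym/(AomegaE dot_norm saA specE); split=> //.
apply: (tight_approx dot_norm specE) => e e0.
have [a a0 [v [[bv dv] Pv gn]]] := proper _ e0.
have [|_ _ bAv tAv] := @regular_segment a v bv (ltW a0).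
  by move=> n; exact/spectral_subspaceP.
exists (fun n => A (v n)) => //.
have gn' : \forall n \near om, graph_norm A (u n - v n) < e.
  exact: cvgr_lt (gn_cvg v dv ux.1 bv bAu bAv) _ gn.
apply: filterS gn' => n; apply: le_lt_trans.
by rewrite -(sa_B saA)//; exact: (gn_ge _).2.
Qed.

End core.

Unset Implicit Arguments.
Set Strict Implicit.
Set Printing Implicit Defensive.

Theorem theorem4p1
  (R : realType)
  (H : completeNormedModType R[i])
  (dot : {dot H for Num.conj})
  (dot_norm : forall x : H, `|x| ^+ 2 = dot x x)
  (H_separable : separable H)
  (H_infinite : infinite_dimensional H)
  (omega : free_ultrafilter)
  (A : partial_op H)
  (A_self_adjoint : self_adjoint dot A)
  (E : set (measurableTypeR R) -> H -> H)
  (E_spectral : spectral_measure_of dot A E) :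
  (KA dot omega E = HA omega A /\
   op_eq (Aomega omega A) (Atilde dot omega E) /\
   is_core (D0 omega E) (Aomega omega A)) /\
  (forall (x : ultrapower H omega) (u : nat -> H),
     dom (Aomega omega A) x ->
     represents u x ->
     (forall n, dom A (u n)) ->
     (bounded_seq (fun n => A (u n)) /\
      ucls omega (fun n => A (u n)) = Aomega omega A x) <->
     proper_A_sequence omega A E u).
Proof.
split; last by move=> x u Dx ux du;
  exact: (regular_iff_proper dot_norm A_self_adjoint E_spectral).
have KH : KA dot omega E = HA omega A.
  apply/seteqP; split=> x; have ux := represents_repr x.
    move=> /(KA_tight dot_norm A_self_adjoint E_spectral ux).
    by move=> /(HA_tight dot_norm A_self_adjoint E_spectral ux).
  move=> /(HA_tight dot_norm A_self_adjoint E_spectral ux).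
  by move=> /(KA_tight dot_norm A_self_adjoint E_spectral ux).
split=> //; split; last first.
  split; [exact: (D0_subspace omega E_spectral)|exact: (D0_sub_DA dot_norm
    A_self_adjoint E_spectral)|].
  exact: (core_closure dot_norm omega A_self_adjoint E_spectral).
(* This limit yields both that elements of [DA] lie in the domain of [Atilde] and that the two
   operators agree there. *)
have gen x : DA omega A x -> exists2 u, regular_for A E u x &
    diff_quot dot E x t @[t --> 0^'] --> 'i%C *: Aomega omega A x.
  move=> Dx; have [u ru] := ex_regular dot_norm A_self_adjoint E_spectral Dx.
  exists u => //; rewrite (AomegaE dot_norm A_self_adjoint E_spectral ru).
  exact: (diff_quot_cvg dot_norm A_self_adjoint E_spectral ru).
split.
  apply/seteqP; split=> x /=; last by move=> [Kx cv];
    exact: (Atilde_dom dot_norm A_self_adjoint E_spectral).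
  move=> Dx; have [u _ cv] := gen x Dx.
  split; last by apply/cvg_ex; exists ('i%C *: Aomega omega A x).
  by rewrite KH; exact: subset_closure.
move=> x Dx; have [u _ cv] := gen x Dx.
rewrite [RHS]/= (cvg_lim _ cv); last exact: norm_hausdorff.
by rewrite scalerA mulVf ?scale1r// eq_complex/= oner_eq0 andbF.
Qed.
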